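(* Let $N\ge1$ and let $J$ satisfy the assumptions stated in the context. Let $\mu\in L^\infty(\mathbb{R}^N)$, $\mu\ge0$, and $$\mathcal{G}_\mu(x,s)=1+\frac{\mu(x)\,s}{2(1+\mu(x)^2s^2)},\qquad (x,s)\in\mathbb{R}^N\times\mathbb{R}.$$ Let $u$ be a solution of the Cauchy problem $$\begin{cases} u_t(x,t)=\displaystyle\int_{\mathbb{R}^N}J(x-y)\,u(y;x,t)\,\mathcal{G}_\mu(x,u(y;x,t))\,dy & \text{in }\mathbb{R}^N\times(0,\infty),\\ u(x,0)=u_0(x) & \text{in }\mathbb{R}^N,\end{cases}$$ with positive initial datum $u_0\in L^1(\mathbb{R}^N)\cap L^\infty(\mathbb{R}^N)\cap\mathcal{C}(\mathbb{R}^N)$ satisfying $$\|u_0\|_{L^\infty(\mathbb{R}^N)}\,\|\mu\|_{L^\infty(\mathbb{R}^N)}<1.$$ Then there exists $\tilde C=\tilde C(\|\mu\|_{L^\infty(\mathbb{R}^N)},\|u_0\|_{L^\infty(\mathbb{R}^N)},N,J)>0$ such that $$\|u(\cdot,t)\|_{L^2(\mathbb{R}^N)}^2\le\tilde C\,\|u_0\|_{L^1(\mathbb{R}^N)}^2\,t^{-\frac N2}$$ for $t$ sufficiently large.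
   Context: Notation: $u(y;x,t):=u(y,t)-u(x,t)$. Assumptions on $J$: $J:\mathbb{R}^N\to\mathbb{R}$ is a nonnegative radially symmetric function with $J\in\mathcal{C}_c(\mathbb{R}^N)$, $\int_{\mathbb{R}^N}J(z)\,dz=1$ and $C(J):=\int_{\mathbb{R}^N}J(z)z_N^2\,dz<\infty$. Solution of the Cauchy problem: a function $u\in\mathcal{C}([0,\infty);\mathcal{C}(\mathbb{R}^N))$ satisfying $u(x,t)=\int_0^t\int_{\mathbb{R}^N}J(x-y)u(y;x,\tau)\mathcal{G}_\mu(x,u(y;x,\tau))\,dy\,d\tau+u_0(x)$ in $\mathbb{R}^N\times(0,\infty)$. *)

(* Defs.v *)
From HB Require Import structures.
From mathcomp Require Import all_boot all_order all_algebra.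
From mathcomp Require Import all_classical all_reals all_analysis.

Set Implicit Arguments.
Unset Strict Implicit.
Unset Printing Implicit Defensive.
Import Order.TTheory GRing.Theory Num.Theory.
Import numFieldNormedType.Exports.
Local Open Scope classical_set_scope.
Local Open Scope ring_scope.

(* R^n is 'rV[R]_n.  As for n.-tuple in the library, its sigma-algebra is
   generated by the coordinate maps; it is the Borel sigma-algebra. *)
Section measurable_row.
Context {R : realType} {n : nat}.

Let coord (i : 'I_n) (x : 'rV[R]_n) : measurableTypeR R := x 0 i.

Let row_set0 : g_sigma_preimage coord set0.
Proof. exact: sigma_algebra0. Qed.

Let row_setC A : g_sigma_preimage coord A -> g_sigma_preimage coord (~` A).
Proof. exact: sigma_algebraC. Qed.

Let row_bigcup (F : _^nat) : (forall i, g_sigma_preimage coord (F i)) ->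
  g_sigma_preimage coord (\bigcup_i (F i)).
Proof. exact: sigma_algebra_bigcup. Qed.

HB.instance Definition _ := @isMeasurable.Build default_measure_display
  'rV[R]_n (g_sigma_preimage coord) row_set0 row_setC row_bigcup.

Lemma measurable_coord (i : 'I_n) :
  measurable_fun [set: 'rV[R]_n] (fun x => x 0 i : measurableTypeR R).
Proof.
move=> _ Y mY; rewrite setTI; apply: sub_sigma_algebra => /=.
rewrite -bigcup_seq/=; exists i => /=; first by rewrite mem_index_enum.
by exists Y => //; rewrite setTI.
Qed.

Lemma measurable_fun_row d (T : measurableType d) (f : T -> 'rV[R]_n) :
  (forall i, measurable_fun [set: T] (fun t => f t 0 i : measurableTypeR R)) ->
  measurable_fun [set: T] f.
Proof.
move=> mf; suff : g_sigma_preimage (fun i => coord i \o f) `<=` measurable.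
  rewrite g_sigma_preimage_comp => + _ A mA; apply; by exists A.
apply: smallest_sub; first exact: sigma_algebra_measurable.
rewrite -bigcup_seq; apply: bigcup_sub => i _ A [B mB <-].
exact: mf.
Qed.

End measurable_row.

Definition row_cons {R : realType} {n : nat}
    (p : measurableTypeR R * 'rV[R]_n) : 'rV[R]_n.+1 :=
  row_mx (const_mx p.1) p.2 : 'rV[R]_(1 + n).

Section row_cons.
Context {R : realType} {n : nat}.

Lemma row_cons0 (p : measurableTypeR R * 'rV[R]_n) : row_cons p 0 ord0 = p.1.
Proof.
have -> : ord0 = lshift n (@ord0 0) by apply/val_inj.
by rewrite /row_cons (@row_mxEl _ 1 1 n) mxE.
Qed.

Lemma row_consS (p : measurableTypeR R * 'rV[R]_n) i :
  row_cons p 0 (lift ord0 i) = p.2 0 i.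
Proof.
have -> : lift ord0 i = rshift 1 i by apply/val_inj.
by rewrite /row_cons (@row_mxEr _ 1 1 n).
Qed.

Lemma measurable_row_cons : measurable_fun setT (@row_cons R n).
Proof.
apply: measurable_fun_row => i; case: (unliftP ord0 i) => [j ->|->].
  under eq_fun do rewrite row_consS.
  exact: (measurableT_comp (measurable_coord j) measurable_snd).
under eq_fun do rewrite row_cons0.
exact: measurable_fst.
Qed.

Definition row_uncons (x : 'rV[R]_n.+1) : measurableTypeR R * 'rV[R]_n :=
  (x 0 ord0, \row_i x 0 (lift ord0 i)).

Lemma row_consK : cancel (@row_cons R n) row_uncons.
Proof.
move=> [a v]; rewrite /row_uncons row_cons0; congr (_, _).
by apply/rowP => i; rewrite mxE row_consS.
Qed.

Lemma row_unconsK : cancel row_uncons (@row_cons R n).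
Proof.
move=> x; apply/rowP => i; case: (unliftP ord0 i) => [j ->|->].
  by rewrite row_consS mxE.
by rewrite row_cons0.
Qed.

Lemma measurable_row_uncons : measurable_fun setT row_uncons.
Proof.
apply/measurable_fun_pairP; split; first exact: measurable_coord.
apply: measurable_fun_row => i; under eq_fun do rewrite /= mxE.
exact: measurable_coord.
Qed.

End row_cons.

Section lebesgue_measure_cons.
Context {R : realType} {n : nat}.
Variable m : {sigma_finite_measure set 'rV[R]_n -> \bar R}.
Local Open Scope ereal_scope.

Definition lebesgue_measure_cons : set 'rV[R]_n.+1 -> \bar R :=
  pushforward (lebesgue_measure \x m) row_cons.

Let mpre A : measurable A -> measurable (@row_cons R n @^-1` A).
Proof. by move=> mA; rewrite -[X in measurable X]setTI; exact: measurable_row_cons. Qed.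

Let cons0 : lebesgue_measure_cons set0 = 0.
Proof. by rewrite /lebesgue_measure_cons /pushforward preimage_set0 measure0. Qed.

Let cons_ge0 A : 0 <= lebesgue_measure_cons A.
Proof. by rewrite /lebesgue_measure_cons /pushforward; exact: (measure_ge0 (lebesgue_measure \x m)). Qed.

Let cons_sigma_additive : semi_sigma_additive lebesgue_measure_cons.
Proof.
move=> F mF tF mUF; rewrite /lebesgue_measure_cons /pushforward preimage_bigcup.
apply: measure_semi_sigma_additive.
- by move=> k; exact: mpre.
- apply/trivIsetP => /= i j _ _ ij; rewrite -preimage_setI.
  by move/trivIsetP : tF => /(_ _ _ _ _ ij) ->//; rewrite preimage_set0.
- by rewrite -preimage_bigcup; exact: mpre.
Qed.

HB.instance Definition _ := isMeasure.Build _ _ _ lebesgue_measure_cons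
  cons0 cons_ge0 cons_sigma_additive.

Let cons_sigma_finite : sigma_finite setT lebesgue_measure_cons.
Proof.
have : sigma_finite setT (@lebesgue_measure R) by exact: sigma_finiteT.
move=> /sigma_finiteP[F [TF ndF Foo]].
have /sigma_finiteP[G [TG ndG Goo]] := sigma_finiteT m.
exists (fun k => row_uncons @^-1` (F k `*` G k)).
  rewrite -preimage_bigcup -[LHS](preimage_setT row_uncons); congr (_ @^-1` _).
  rewrite -setXTT TF TG predeqE => -[x y]; split => [|[k _ []/= ? ?]].
    move=> [/= [i _ Fix] [k _ Gky]]; exists (maxn i k) => //; split.
    - by move: x Fix; exact/subsetPset/ndF/leq_maxl.
    - by move: y Gky; exact/subsetPset/ndG/leq_maxr.
  by split; exists k.
move=> k; have [mF ?] := Foo k; have [mG ?] := Goo k; split.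
  rewrite -[X in measurable X]setTI.
  by apply: measurable_row_uncons => //; exact: measurableX.
rewrite /lebesgue_measure_cons /pushforward -comp_preimage.
rewrite (_ : row_uncons \o row_cons = id); last by apply/funext => p; exact: row_consK.
by rewrite preimage_id product_measure1E// lte_mul_pinfty// ge0_fin_numE.
Qed.

HB.instance Definition _ := Measure_isSigmaFinite.Build _ _ _
  lebesgue_measure_cons cons_sigma_finite.

End lebesgue_measure_cons.

Section lebesgue_measure_row.
Context {R : realType}.
Local Open Scope ereal_scope.

Fixpoint lebesgue_measure_row (n : nat) :
    {sigma_finite_measure set 'rV[R]_n -> \bar R} :=
  if n is k.+1 then lebesgue_measure_cons (lebesgue_measure_row k)
  else dirac (0%R : 'rV[R]_0).

Lemma lebesgue_measure_row_box n (B : 'I_n -> set (measurableTypeR R)) :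
  (forall i, measurable (B i)) ->
  lebesgue_measure_row n [set x : 'rV[R]_n | forall i, B i (x 0%R i)] =
  \prod_(i < n) lebesgue_measure (B i).
Proof.
elim: n B => [|n ih] B mB.
  by rewrite big_ord0 /= diracE mem_set// => -[].
rewrite big_ord_recl -ih// -product_measure1E//; last first.
  rewrite [X in measurable X](_ : _ =
      \bigcap_(i in [set: 'I_n]) (fun x : 'rV[R]_n => x 0%R i) @^-1` B (lift ord0 i)).
    apply: fin_bigcap_measurable => // i _.
    by rewrite -[X in measurable X]setTI; exact: measurable_coord.
  by apply/seteqP; split => [x xB i _|x xB i]; [exact: xB|exact: (xB i)].
rewrite /= /lebesgue_measure_cons /pushforward; congr ((_ \x _) _).
apply/seteqP; split => [p /= pB|p /= [p1 p2] i].
  by split=> [|i]; [have := pB ord0; rewrite row_cons0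
                   |have := pB (lift ord0 i); rewrite row_consS].
by case: (unliftP ord0 i) => [j ->|->]; rewrite ?row_consS ?row_cons0.
Qed.

End lebesgue_measure_row.

Notation "''leb_' n" := (lebesgue_measure_row n)
  (at level 8, n at level 2, format "''leb_' n").

(* Euclidean spheres are described by the squared Euclidean norm, the library
   norm of 'rV[R]_n being the sup norm. *)
Definition radially_symmetric {R : realType} {n : nat} (J : 'rV[R]_n -> R) :=
  forall x y : 'rV[R]_n, \sum_i x 0 i ^+ 2 = \sum_i y 0 i ^+ 2 -> J x = J y.

(* The dimension N >= 1 is n.+1, so that z_N is z 0 ord_max. *)
Record admissible_kernel {R : realType} {n : nat} (J : 'rV[R]_n.+1 -> R) : Prop := {
  kernel_ge0 : forall z, 0 <= J z ;
  kernel_radial : radially_symmetric J ;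
  kernel_continuous : continuous J ;
  kernel_compact_support : compact (closure [set z | J z != 0]) ;
  kernel_mass1 : (\int['leb_n.+1]_z (J z)%:E = 1)%E ;
  kernel_moment2 : (\int['leb_n.+1]_z (J z * z 0 ord_max ^+ 2)%:E < +oo)%E
}.

Definition Gmu {R : realType} {n : nat} (mu : 'rV[R]_n -> R)
    (x : 'rV[R]_n) (s : R) : R :=
  1 + mu x * s / (2 * (1 + mu x ^+ 2 * s ^+ 2)).

(* u(y; x, t); the time variable comes first throughout. *)
Definition increment {R : realType} {n : nat} (u : R -> 'rV[R]_n -> R)
    (y x : 'rV[R]_n) (t : R) : R := u t y - u t x.

(* u belongs to C([0, oo); C(R^n)), where C(R^n) carries the topology of
   uniform convergence on R^n (the one of the sup norm).  Local uniform
   convergence would be too weak: it admits Tychonoff-type solutions, unbounded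
   in x for t > 0, already when mu = 0. *)
Definition cauchy_solution {R : realType} {n : nat} (J mu u0 : 'rV[R]_n -> R)
    (u : R -> 'rV[R]_n -> R) : Prop :=
  [/\ forall t, 0 <= t -> continuous (u t),
      {within `[0, +oo[, continuous (u : R -> {uniform 'rV[R]_n -> R})} &
      forall x t, 0 < t ->
        u t x = (\int[lebesgue_measure]_(tau in `[0, t])
                   (\int['leb_n]_y (J (x - y) * increment u y x tau
                                    * Gmu mu x (increment u y x tau))))
                + u0 x].

(* Main.v *)
Require Import Defs.
From HB Require Import structures.
From mathcomp Require Import all_boot all_order all_algebra.
From mathcomp Require Import all_classical all_reals all_analysis.
From mathcomp Require Import measurable_realfun ess_sup_inf.
From mathcomp Require Import ring lra.
Import Order.TTheory GRing.Theory Num.Theory.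
Import numFieldNormedType.Exports.
Local Open Scope classical_set_scope.
Local Open Scope ring_scope.

Set Implicit Arguments.
Unset Strict Implicit.
Unset Printing Implicit Defensive.

(* Write s G_mu(x, s) = s + mu s^2 / (2 (1 + mu^2 s^2)), which is nondecreasing
   and 2-Lipschitz in s.  The explicit Euler step v |-> v + h F(v) is therefore
   order preserving and commutes with constants as soon as 2 h <= 1: it maps
   [0, M] into itself and is nonexpansive for the sup norm, so the Euler
   iterates converge to u, uniformly on R^N.  Every integral estimate is made on
   the iterates and passed to u by Fatou's lemma; in this way no integrability
   of u, and no derivative in time, is ever needed.

   Let D(v) be the double integral of J(x - y) (v(y) - v(x))^2, m a bound of mu,
   M one of u0, and delta = 1 - m M > 0.  One Euler step satisfies
     int v'^2 + (delta / 2) h D(v) <= int v^2,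
     int v' <= int v + (h m / 2) D(v),
   so the L^1 norms of the iterates stay below (1 + m M / delta) times that of
   u0.  The decay then follows from the nonlocal Nash inequality
     int v^2 <= C rho^2 D(v) + rho^-N (int v)^2     (rho >= r),
   in which rho is taken proportional to sqrt t.  For the Nash inequality, let
   E(k) be the integral of (v(x + k) - v(x))^2.  Since D(v) is the integral of
   J E, and J is bounded below on some cube, the quasi-triangle inequality for E
   bounds E(k) by D(v) for small k, hence by a multiple of rho^2 D(v) for all
   |k| <= rho; it remains to average E(k) = 2 int v^2 - 2 int v(x) v(x + k)
   over the cube of radius rho. *)

(** * Lebesgue measure on row vectors *)

Section row_measurability.
Context {R : realType}.

(** The balls of the sup norm are boxes, hence measurable through the coordinates, and an open set
    is the countable union of the boxes with rational centre and radius 1 / (k + 1) that it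
    contains. *)
Lemma open_measurable_row n (A : set 'rV[R]_n) : open A -> measurable A.
Proof.
move=> oA.
pose B (q : 'rV[rat]_n) k := [set x : 'rV[R]_n | forall i,
  x 0 i \in `]ratr (q 0 i) - k.+1%:R^-1, ratr (q 0 i) + k.+1%:R^-1[].
have mB q k : measurable (B q k).
  rewrite [X in measurable X](_ : _ = \bigcap_(i in [set: 'I_n])
     (fun x : 'rV[R]_n => x 0 i : measurableTypeR R) @^-1`
     `]ratr (q 0 i) - k.+1%:R^-1, ratr (q 0 i) + k.+1%:R^-1[%classic).
    apply: fin_bigcap_measurable => // i _.
    rewrite -[X in measurable X]setTI; apply: measurable_coord => //.
  by apply/seteqP; split => [x xB i _|x xB i]; [exact: xB|exact: (xB i)].
have -> : A = \bigcup_(p : 'rV[rat]_n * nat)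
    (if `[< B p.1 p.2 `<=` A >] then B p.1 p.2 else set0).
  apply/seteqP; split => [x Ax|x [p _]]; last by case: asboolP => // + Bx; apply.
  have /nbhs_ballP[e /= e0 eA] : nbhs x A by exact: open_nbhs_nbhs.
  have [k /= ke] : exists k, k.+1%:R^-1 < e / 2.
    have e2 : 0 < e / 2 by rewrite divr_gt0.
    near \oo => k; exists k; near: k; exact: near_infty_natSinv_lt (PosNum e2).
  (* Each coordinate of the centre lies within 1 / (k + 1) of that of x, so the box contains x and
     has all its points within 2 / (k + 1) < e of x. *)
  have /choice[q qx] : forall i, exists q : rat,
      ratr q \in `]x 0 i - k.+1%:R^-1, x 0 i + k.+1%:R^-1[.
    by move=> i; apply: rat_in_itvoo; rewrite ltrBlDr -addrA ltrDl addr_gt0// invr_gt0.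
  exists (\row_i q i, k) => //=; case: asboolP => [_ i|].
    by rewrite mxE; have := qx i; rewrite !in_itv /=; move: (k.+1%:R^-1) => r /andP[? ?];
      apply/andP; split; lra.
  case=> y By; apply: eA; split => // i j.
  rewrite (ord1 i) /ball /= ltr_norml.
  have := By j; have := qx j; rewrite mxE !in_itv /=;
    move: (k.+1%:R^-1) ke => r ? /andP[? ?] /andP[? ?].
  by apply/andP; split; lra.
apply: countable_bigcupT_measurable => [|p]; first exact: countableP.
case: asboolP => // _; exact: mB.
Unshelve. all: by end_near. Qed.

Lemma continuous_measurable_row n (f : 'rV[R]_n -> R) :
  continuous f -> measurable_fun setT f.
Proof.
move=> /continuousP cf; apply: (measurability _ (RGenOpens.measurableE R)).
move=> _ [_ [a [b ->] <-]]; rewrite setTI; apply: open_measurable_row.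
exact/cf/interval_open.
Qed.

Lemma measurable_addrow n (a : 'rV[R]_n) :
  measurable_fun setT (fun x : 'rV[R]_n => x + a).
Proof.
apply: measurable_fun_row => i; under eq_fun do rewrite mxE.
by apply: measurable_funD => //; exact: measurable_coord.
Qed.

Lemma measurable_row_add n :
  measurable_fun setT (fun p : 'rV[R]_n * 'rV[R]_n => p.1 + p.2).
Proof.
apply: measurable_fun_row => i; under eq_fun do rewrite mxE.
by apply: measurable_funD; apply: (measurableT_comp (measurable_coord i));
  [exact: measurable_fst|exact: measurable_snd].
Qed.

Lemma measurable_row_sub n :
  measurable_fun setT (fun p : 'rV[R]_n * 'rV[R]_n => p.1 - p.2).
Proof.
apply: measurable_fun_row => i; under eq_fun do rewrite !mxE.
by apply: measurable_funB; apply: (measurableT_comp (measurable_coord i));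
  [exact: measurable_fst|exact: measurable_snd].
Qed.

Lemma measurable_row_opp n : measurable_fun setT (fun x : 'rV[R]_n => - x).
Proof.
apply: measurable_fun_row => i; under eq_fun do rewrite mxE.
by apply: measurableT_comp => //; exact: measurable_coord.
Qed.

End row_measurability.

(** * Translation invariance and Tonelli's theorem *)

Section translation_invariance.
Context {R : realType}.
Local Open Scope ereal_scope.

(** The pushforward of the measure by the translation agrees with it on half-open intervals, which
    determine it. *)
Lemma integral_lebesgue_translation (a : R) (f : R -> \bar R) :
  measurable_fun setT f -> (forall x, 0 <= f x) ->
  \int[lebesgue_measure]_x f (x + a)%R = \int[lebesgue_measure]_x f x.
Proof.
move=> mf f0.
have ma : measurable_fun [set: measurableTypeR R]
    (fun x => x + a : measurableTypeR R)%R by exact: measurable_funD.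
have <- : \int[pushforward lebesgue_measure
    (fun x => x + a : measurableTypeR R)%R]_x f x =
    \int[lebesgue_measure]_x f (x + a)%R.
  by rewrite ge0_integral_pushforward// preimage_setT.
apply: eq_measure_integral => /= A mA _.
apply/esym/lebesgue_measure_unique => //= _ [[b c]] _ <-.
rewrite /pushforward (_ : _ @^-1` _ = `](b - a)%R, (c - a)%R]%classic); last first.
  by apply/seteqP; split => x /=; rewrite !in_itv /= ltrBlDr lerBrDr.
rewrite !lebesgue_measure_itv/= !lte_fin ltrD2r.
by case: ifP => // _; congr EFin; ring.
Qed.

Lemma integral_leb_cons n (f : 'rV[R]_n.+1 -> \bar R) :
  measurable_fun setT f -> (forall x, 0 <= f x) ->
  \int['leb_n.+1]_x f x =
  \int[lebesgue_measure]_s \int['leb_n]_v f (row_cons (s, v)).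
Proof.
move=> mf f0; have mrc := @measurable_row_cons R n.
rewrite -(fubini_tonelli1 (f \o row_cons))//.
  by rewrite /= /lebesgue_measure_cons ge0_integral_pushforward// preimage_setT.
  by apply: measurableT_comp.
by move=> x /=.
Qed.

(** Induction on the dimension: the first coordinate is split off by Tonelli, the inner integral is
    translated by the induction hypothesis and the outer one by the one-dimensional case. *)
Lemma integral_leb_translation n (a : 'rV[R]_n) (f : 'rV[R]_n -> \bar R) :
  measurable_fun setT f -> (forall x, 0 <= f x) ->
  \int['leb_n]_x f ((x : 'rV[R]_n) + a)%R = \int['leb_n]_x f x.
Proof.
elim: n a f => [|n ih] a f mf f0.
  by apply: eq_integral => x _; congr f; apply/rowP => -[].
have mrc := @measurable_row_cons R n.
have mfa : measurable_fun setT (fun x : 'rV[R]_n.+1 => f (x + a)%R).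
  by apply: measurableT_comp => //; exact: measurable_addrow.
rewrite (integral_leb_cons mfa (fun x => f0 (x + a)%R)) (integral_leb_cons mf f0).
pose b : 'rV[R]_n := (\row_i a 0 (lift ord0 i))%R.
transitivity (\int[lebesgue_measure]_s \int['leb_n]_v f (row_cons (s + a 0 ord0, v)%R)).
  apply: eq_integral => s _.
  rewrite -(ih b (fun v => f (row_cons (s + a 0 ord0, v)%R)))//; last first.
    by do 2 apply: measurableT_comp => //; exact: measurable_pair1.
  apply: eq_integral => v _; congr f; apply/rowP => i; rewrite mxE.
  case: (unliftP ord0 i) => [j ->|->].
    by rewrite !row_consS /= !mxE.
  by rewrite !row_cons0.
apply: (integral_lebesgue_translation _
  (f := fun s => \int['leb_n]_v f (row_cons (s, v)%R))).
  apply: (measurable_fun_fubini_tonelli_F (f \o row_cons)).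
    exact: measurableT_comp.
  by move=> x /=.
by move=> x; apply: integral_ge0.
Qed.

End translation_invariance.

Section nonneg_leb_integral.
Context {R : realType} {n : nat}.
Implicit Types f g : 'rV[R]_n -> \bar R.
Local Open Scope ereal_scope.

Lemma ge0_lebZ (k : R) f : measurable_fun setT f -> (forall x, 0 <= f x) ->
  (0 <= k)%R -> \int['leb_n]_x (k%:E * f x) = k%:E * \int['leb_n]_x f x.
Proof. by move=> mf f0 k0; exact: ge0_integralZl_EFin. Qed.

Lemma ge0_lebD f g : measurable_fun setT f -> (forall x, 0 <= f x) ->
  measurable_fun setT g -> (forall x, 0 <= g x) ->
  \int['leb_n]_x (f x + g x) = \int['leb_n]_x f x + \int['leb_n]_x g x.
Proof. by move=> mf f0 mg g0; exact: ge0_integralD. Qed.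

Lemma ge0_leb_le f g : measurable_fun setT f -> (forall x, 0 <= f x) ->
  measurable_fun setT g -> (forall x, f x <= g x) ->
  \int['leb_n]_x f x <= \int['leb_n]_x g x.
Proof. by move=> mf f0 mg fg; exact: ge0_le_integral. Qed.

Lemma ge0_leb_tonelli m (f : 'rV[R]_n * 'rV[R]_m -> \bar R) :
  measurable_fun setT f -> (forall p, 0 <= f p) ->
  \int['leb_n]_x \int['leb_m]_y f (x, y) = \int['leb_m]_y \int['leb_n]_x f (x, y).
Proof. by move=> mf f0; exact: fubini_tonelli. Qed.

End nonneg_leb_integral.

(** * The flux and the Euler step *)

Section flux.
Context {R : realType}.
Implicit Types m s t : R.

(** This is [s * Gmu mu x s] with the value [mu x] frozen to the number m. *)
Definition flux m s := s * (1 + m * s / (2 * (1 + m ^+ 2 * s ^+ 2))).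

Lemma fluxE m s : flux m s = s + m * s ^+ 2 / (2 * (1 + (m * s) ^+ 2)).
Proof. by rewrite /flux exprMn; ring. Qed.

Lemma flux0 m : flux m 0 = 0.
Proof. by rewrite /flux mul0r. Qed.

Let one_sqr_gt0 (a : R) : 0 < 1 + a ^+ 2.
Proof. by rewrite ltr_pwDl// sqr_ge0. Qed.

(** With a = m t and b = m s, the difference quotient is 1 + (a + b) / (2 (1 + a^2) (1 + b^2)).
    Since |a + b| <= (1 + a^2) (1 + b^2), it lies between 1/2 and 3/2, whatever the sign of m. *)
Lemma flux_diff m s t : s <= t ->
  0 <= flux m t - flux m s /\ flux m t - flux m s <= 2 * (t - s).
Proof.
move=> st; rewrite !fluxE.
have := one_sqr_gt0 (m * s); have := one_sqr_gt0 (m * t).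
set P := 1 + (m * t) ^+ 2; set Q := 1 + (m * s) ^+ 2 => P0 Q0.
have -> : t + m * t ^+ 2 / (2 * P) - (s + m * s ^+ 2 / (2 * Q)) =
    (t - s) * (1 + (m * t + m * s) / (2 * (P * Q))).
  rewrite /P /Q; field.
  by apply/andP; split; rewrite lt0r_neq0.
have PQ : `|m * t + m * s| <= P * Q.
  rewrite ler_norml /P /Q; move: (m * t) (m * s) => a b.
  by have := sqr_ge0 (a - 1); have := sqr_ge0 (a + 1); have := sqr_ge0 (b - 1);
     have := sqr_ge0 (b + 1); have := sqr_ge0 (a * b); rewrite !expr2 => *;
     apply/andP; split; nra.
have {PQ}: `|(m * t + m * s) / (2 * (P * Q))| <= 1 / 2.
  have PQ0 : 0 < P * Q by exact: mulr_gt0.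
  rewrite normrM normfV (gtr0_norm (_ : 0 < 2 * (P * Q))) ?mulr_gt0//.
  by rewrite ler_pdivrMr ?mulr_gt0// (_ : 1 / 2 * (2 * (P * Q)) = P * Q)//; field.
rewrite ler_norml => /andP[h1 h2]; move: (_ / (2 * _)) h1 h2 => r h1 h2.
by split; nra.
Qed.

Lemma flux_homo m s t : s <= t -> flux m s <= flux m t.
Proof. by move=> /(flux_diff m)[+ _]; rewrite subr_ge0. Qed.

Lemma flux_lip m s t : s <= t -> flux m t <= flux m s + 2 * (t - s).
Proof. by move=> /(flux_diff m)[_]; rewrite lerBlDl. Qed.

Lemma flux_dist m s t : `|flux m t - flux m s| <= 2 * `|t - s|.
Proof.
have [st|/ltW ts] := leP s t.
  by have [h1 h2] := flux_diff m st; rewrite !ger0_norm ?subr_ge0// -subr_ge0.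
have [h1 h2] := flux_diff m ts.
by rewrite distrC [X in _ <= 2 * X]distrC !ger0_norm ?subr_ge0// -subr_ge0.
Qed.

Lemma norm_flux_le m s : `|flux m s| <= 2 * `|s|.
Proof. by have := flux_dist m 0 s; rewrite flux0 !subr0. Qed.

Lemma flux_le m b s : 0 <= b -> m <= b -> flux m s <= s + b / 2 * s ^+ 2.
Proof.
move=> b0 mb; rewrite fluxE lerD2l.
have P0 := one_sqr_gt0 (m * s).
rewrite ler_pdivrMr ?mulr_gt0//.
have -> : b / 2 * s ^+ 2 * (2 * (1 + (m * s) ^+ 2)) =
  b * s ^+ 2 + b * (s ^+ 2 * (m * s) ^+ 2) by field.
rewrite -[leLHS]addr0 lerD// ?ler_wpM2r ?sqr_ge0//.
by apply: mulr_ge0 => //; apply: mulr_ge0; exact: sqr_ge0.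
Qed.

Lemma measurable_flux d (T : measurableType d) (f g : T -> R) :
  measurable_fun setT f -> measurable_fun setT g ->
  measurable_fun setT (fun x => flux (f x) (g x)).
Proof.
move=> mf mg.
have mphi : measurable_fun setT (fun a : R => a / (2 * (1 + a ^+ 2))).
  apply: continuous_measurable_fun => a.
  apply: cvgM; first exact: cvg_id.
  apply: cvgV; first by rewrite mulf_neq0// lt0r_neq0.
  apply: cvgM; first exact: cvg_cst.
  by apply: cvgD; [exact: cvg_cst|exact: exprn_continuous].
rewrite (_ : (fun _ => _) = (fun x => g x * (1 + (f x * g x) / (2 * (1 + (f x * g x) ^+ 2))))).
  apply: measurable_funM => //; apply: measurable_funD => //.
  by apply: (measurableT_comp mphi); exact: measurable_funM.
by apply/funext => x; rewrite /flux exprMn.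
Qed.

End flux.

(** * Averages against the kernel *)

Section average.
Context {R : realType} {n : nat}.
Notation V := 'rV[R]_n.+1.
Notation leb := (@lebesgue_measure_row R n.+1).
Variables (J : V -> R) (hJ : admissible_kernel J).
Implicit Types (f g : V -> R) (x : V) (c : R).

Lemma kernel_measurable : measurable_fun setT J.
Proof. by apply: continuous_measurable_row; case: hJ. Qed.

Lemma kernelN z : J (- z) = J z.
Proof.
by apply: (kernel_radial hJ); apply: eq_bigr => i _; rewrite mxE sqrrN.
Qed.

Lemma measurable_kernel_sub x : measurable_fun setT (fun y : V => J (x - y)).
Proof.
apply: measurableT_comp; first exact: kernel_measurable.
under eq_fun do rewrite addrC.
apply: (measurableT_comp (measurable_addrow x)); exact: measurable_row_opp.
Qed.

Lemma integral_kernel_sub x : (\int[leb]_y (J (x - y))%:E = 1)%E.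
Proof.
rewrite -(kernel_mass1 hJ) -[RHS](integral_leb_translation (- x))//.
- by apply: eq_integral => y _; rewrite -kernelN opprB.
- by apply/measurable_EFinP; exact: kernel_measurable.
- by move=> y; rewrite lee_fin (kernel_ge0 hJ).
Qed.

(** The bound is asked only where J (x - y) does not vanish. As J has compact support, every
    continuous function qualifies; this covers [u t], for which no bound on the whole space is
    available beforehand. *)
Definition jbounded x f := measurable_fun setT f /\
  exists B, forall y, J (x - y) != 0 -> `|f y| <= B.

Definition avg x f := \int[leb]_y (J (x - y) * f y).

Lemma integrable_kernel_sub x : leb.-integrable setT (fun y : V => (J (x - y))%:E).
Proof.
apply/integrableP; split.
  by apply/measurable_EFinP; exact: measurable_kernel_sub.
under eq_integral => y _ do rewrite /= ger0_norm ?(kernel_ge0 hJ)//.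
by rewrite integral_kernel_sub ltry.
Qed.

Lemma jbounded_integrable x f : jbounded x f ->
  leb.-integrable setT (EFin \o (fun y : V => J (x - y) * f y)).
Proof.
move=> [mf [B fB]].
apply: (le_integrable _ _ _ (integrableZl measurableT B (integrable_kernel_sub x))) => //=.
  apply/measurable_EFinP; apply: measurable_funM => //; exact: measurable_kernel_sub.
move=> y _; rewrite lee_fin !normrM mulrC.
have [->|/fB fyB] := eqVneq (J (x - y)) 0; first by rewrite normr0 !mulr0.
by rewrite ler_wpM2r// (le_trans fyB)// ler_norm.
Qed.

Lemma jbounded_bounded x f B : measurable_fun setT f ->
  (forall y, `|f y| <= B) -> jbounded x f.
Proof. by move=> mf fB; split=> //; exists B => y _. Qed.

Lemma jbounded_cst x c : jbounded x (fun=> c).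
Proof. exact: (@jbounded_bounded _ _ `|c|). Qed.

Lemma jboundedD x f g : jbounded x f -> jbounded x g ->
  jbounded x (fun y => f y + g y).
Proof.
move=> [mf [B fB]] [mg [C gC]]; split; first exact: measurable_funD.
by exists (B + C) => y Jy; rewrite (le_trans (ler_normD _ _))// lerD ?fB ?gC.
Qed.

Lemma jboundedM x f g : jbounded x f -> jbounded x g ->
  jbounded x (fun y => f y * g y).
Proof.
move=> [mf [B fB]] [mg [C gC]]; split; first exact: measurable_funM.
by exists (B * C) => y Jy; rewrite normrM ler_pM ?fB ?gC.
Qed.

Lemma jboundedZ x c f : jbounded x f -> jbounded x (fun y => c * f y).
Proof. exact/jboundedM/jbounded_cst. Qed.

Lemma jboundedB x f g : jbounded x f -> jbounded x g ->
  jbounded x (fun y => f y - g y).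
Proof.
move=> hf /(jboundedZ (-1)) hg; have := jboundedD hf hg.
by under eq_fun do rewrite mulN1r.
Qed.

Lemma jbounded_incr x c f : jbounded x f -> jbounded x (fun y => f y - c).
Proof. by move=> hf; apply: jboundedB => //; exact: jbounded_cst. Qed.

Lemma jbounded_flux x m f : jbounded x f -> jbounded x (fun y => flux m (f y)).
Proof.
move=> [mf [B fB]]; split; first exact: measurable_flux.
exists (2 * B) => y Jy; rewrite (le_trans (norm_flux_le _ _))//.
by rewrite ler_pM2l// fB.
Qed.

(** The function is bounded on the image of the compact support of J under z |-> x - z. *)
Lemma continuous_jbounded x f : continuous f -> jbounded x f.
Proof.
move=> cf; split; first exact: continuous_measurable_row.
pose K := closure [set z | J z != 0].
have /compact_bounded [B [_ BK]] : compact ((fun z => f (x - z)) @` K).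
  apply: continuous_compact; last exact: (kernel_compact_support hJ).
  apply: continuous_subspaceT => z.
  apply: (@continuous_comp _ _ _ (fun z : V => x - z) f); last exact: cf.
  by apply: continuousB; [apply: cst_continuous|move=> ?; apply].
exists (B + 1) => y Jy; apply: BK; first by rewrite ltrDl.
exists (x - y); last by rewrite subKr.
exact: subset_closure.
Qed.

Lemma avg_le x f g : jbounded x f -> jbounded x g ->
  (forall y, f y <= g y) -> avg x f <= avg x g.
Proof.
move=> /jbounded_integrable hf /jbounded_integrable hg fg.
by apply: le_Rintegral => // y _; rewrite ler_wpM2l// (kernel_ge0 hJ).
Qed.

Lemma avgD x f g : jbounded x f -> jbounded x g ->
  avg x (fun y => f y + g y) = avg x f + avg x g.
Proof.
move=> /jbounded_integrable hf /jbounded_integrable hg; rewrite /avg -RintegralD//.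
by apply: eq_Rintegral => y _; rewrite mulrDr.
Qed.

Lemma avgZ x c f : jbounded x f -> avg x (fun y => c * f y) = c * avg x f.
Proof.
move=> /jbounded_integrable hf; rewrite /avg -RintegralZl//.
by apply: eq_Rintegral => y _; rewrite mulrCA.
Qed.

Lemma avg_cst x c : avg x (fun=> c) = c.
Proof.
rewrite /avg RintegralZr//; last exact: integrable_kernel_sub.
by rewrite /Rintegral integral_kernel_sub /= mul1r.
Qed.

Lemma avgB x f g : jbounded x f -> jbounded x g ->
  avg x (fun y => f y - g y) = avg x f - avg x g.
Proof.
move=> hf hg; rewrite -mulN1r -avgZ// -avgD//; last exact: jboundedZ.
by apply: eq_Rintegral => y _; rewrite mulN1r.
Qed.

Lemma avg_ge0 x f : (forall y, 0 <= f y) -> 0 <= avg x f.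
Proof.
by move=> f0; apply: Rintegral_ge0 => y _; rewrite mulr_ge0// (kernel_ge0 hJ).
Qed.

(** Jensen's inequality, obtained by averaging 2 a f <= f^2 + a^2 with a the mean of f. *)
Lemma avg_sqr_le x f : jbounded x f -> avg x f ^+ 2 <= avg x (fun y => f y ^+ 2).
Proof.
move=> hf; have hf2 : jbounded x (fun y => f y ^+ 2).
  by under eq_fun do rewrite expr2; exact: jboundedM.
set a := avg x f.
have : avg x (fun y => 2 * a * f y) <= avg x (fun y => f y ^+ 2 + a ^+ 2).
  apply: avg_le => [||y].
  - exact: jboundedZ.
  - by apply: jboundedD => //; exact: jbounded_cst.
  - by have := sqr_ge0 (f y - a); rewrite !expr2; nra.
rewrite avgZ// -/a avgD//; last exact: jbounded_cst.
by rewrite avg_cst !expr2; nra.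
Qed.

Lemma EFin_avg x f : jbounded x f ->
  (avg x f)%:E = (\int[leb]_y (J (x - y) * f y)%:E)%E.
Proof.
by move=> /jbounded_integrable hf; rewrite /avg /Rintegral fineK// integrable_fin_num.
Qed.

End average.

Section euler_step.
Context {R : realType} {n : nat}.
Notation V := 'rV[R]_n.+1.
Variables (J : V -> R) (hJ : admissible_kernel J) (mu : V -> R).
Implicit Types (v w : V -> R) (x : V) (c h : R).

Definition drift v x := avg J x (fun y => flux (mu x) (v y - v x)).

Definition euler h v x := v x + h * drift v x.

(** Let e = w x + c - v x >= 0 be the gap at x. Then v y - v x <= w y - w x + e, so the flux being
    monotone and 2-Lipschitz gives drift v <= drift w + 2 e. The loss 2 h e is absorbed by the gap
    e, which is where 2 h <= 1 enters. *)
Lemma euler_comparison h c v w x : 0 <= h -> 2 * h <= 1 ->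
  jbounded J x v -> jbounded J x w -> (forall y, v y <= w y + c) ->
  euler h v x <= euler h w x + c.
Proof.
move=> h0 h1 hv hw vw.
pose e := c + w x - v x.
have e0 : 0 <= e by rewrite /e; have := vw x; lra.
have hf z u : jbounded J x u -> jbounded J x (fun y => flux (mu x) (u y - z)).
  by move=> ?; apply/jbounded_flux/jbounded_incr.
have : drift v x <= avg J x (fun y => flux (mu x) (w y - w x) + 2 * e).
  apply: (avg_le hJ); [exact: hf| |move=> y].
    by apply: jboundedD; [exact: hf|exact: jbounded_cst].
  have se : v y - v x <= w y - w x + e by rewrite /e; have := vw y; lra.
  rewrite (le_trans (flux_homo _ se))//.
  have le_e : w y - w x <= w y - w x + e by rewrite lerDl.
  by rewrite (le_trans (flux_lip _ le_e))// lerD2l ler_pM2l// addrC addKr.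
rewrite (avgD hJ); [|exact: hf|exact: jbounded_cst].
rewrite (avg_cst hJ) /euler -/(drift w x); move: (drift v x) (drift w x) => a b ab.
have : h * a <= h * (b + 2 * e) by rewrite ler_wpM2l.
have : 2 * h * e <= 1 * e by rewrite ler_wpM2r.
by rewrite /e; lra.
Qed.

Lemma drift_cst c x : drift (fun=> c) x = 0.
Proof.
rewrite /drift -[RHS](avg_cst hJ x); apply: eq_Rintegral => y _.
by rewrite subrr flux0.
Qed.

(** Comparison with the zero function, a fixed point of the step: with shift 0 from below and with
    shift M from above. *)
Lemma euler_range h v M x : 0 <= h -> 2 * h <= 1 -> measurable_fun setT v ->
  (forall y, 0 <= v y <= M) -> 0 <= euler h v x <= M.
Proof.
move=> h0 h1 mv vM.
have hv : jbounded J x v.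
  apply: (@jbounded_bounded _ _ _ _ _ M) => // y.
  by have /andP[? ?] := vM y; rewrite ger0_norm.
have h0' := jbounded_cst J x 0.
have e0 : euler h (fun=> 0) x = 0 by rewrite /euler drift_cst mulr0 addr0.
apply/andP; split.
  have := @euler_comparison h 0 (fun=> 0) v x h0 h1 h0' hv.
  by rewrite e0 addr0; apply => y; rewrite addr0; case/andP: (vM y).
have := @euler_comparison h M v (fun=> 0) x h0 h1 hv h0'.
by rewrite e0 add0r; apply => y; case/andP: (vM y).
Qed.

Lemma euler_nonexpansive h c v w : 0 <= h -> 2 * h <= 1 ->
  (forall x, jbounded J x v) -> (forall x, jbounded J x w) ->
  (forall x, `|v x - w x| <= c) -> forall x, `|euler h v x - euler h w x| <= c.
Proof.
move=> h0 h1 hv hw vw x; rewrite ler_norml.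
have vw' y : v y <= w y + c by have := vw y; rewrite ler_norml; lra.
have wv' y : w y <= v y + c by have := vw y; rewrite ler_norml; lra.
have := euler_comparison h0 h1 (hv x) (hw x) vw'.
have := euler_comparison h0 h1 (hw x) (hv x) wv'.
by move=> ? ?; apply/andP; split; lra.
Qed.

(** The factor 4 is the Lipschitz constant 2 of the flux times 2, since the values at y and at x
    both change. *)
Lemma drift_dist c v w x : jbounded J x v -> jbounded J x w ->
  (forall y, `|v y - w y| <= c) -> `|drift v x - drift w x| <= 4 * c.
Proof.
move=> hv hw vw.
have hf u : jbounded J x u -> jbounded J x (fun y => flux (mu x) (u y - u x)).
  by move=> ?; apply/jbounded_flux/jbounded_incr.
have bnd y : `|flux (mu x) (v y - v x) - flux (mu x) (w y - w x)| <= 4 * c.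
  rewrite (le_trans (flux_dist _ _ _))//.
  rewrite (_ : 4 * c = 2 * (c + c)); last by ring.
  rewrite ler_pM2l// (_ : _ - _ - _ = (v y - w y) - (v x - w x)); last by ring.
  by rewrite (le_trans (ler_normB _ _))// lerD.
rewrite /drift -(avgB hJ); [|exact: hf|exact: hf].
have hd := jboundedB (hf _ hv) (hf _ hw).
rewrite ler_norml; apply/andP; split.
  rewrite -[leLHS](avg_cst hJ x); apply: (avg_le hJ) => //; first exact: jbounded_cst.
  by move=> y; have := bnd y; rewrite ler_norml => /andP[].
rewrite -[leRHS](avg_cst hJ x); apply: (avg_le hJ) => //; first exact: jbounded_cst.
by move=> y; have := bnd y; rewrite ler_norml => /andP[].
Qed.

End euler_step.

(** * Nonlocal Nash inequality *)

Section nash.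
Context {R : realType} {n : nat}.
Notation V := 'rV[R]_n.+1.
Notation leb := (@lebesgue_measure_row R n.+1).
Local Open Scope ereal_scope.

Definition cube (z : V) (r : R) : set V := [set x | forall i, (`|x 0 i - z 0 i| <= r)%R].

Lemma cubeE (z : V) (r : R) : cube z r =
  [set x | forall i, `[(z 0 i - r)%R, (z 0 i + r)%R]%classic (x 0%R i)].
Proof.
by apply/seteqP; split => x /= xz i; have := xz i; rewrite ler_distl in_itv /=.
Qed.

Lemma measurable_cube (z : V) (r : R) : measurable (cube z r).
Proof.
rewrite cubeE [X in measurable X](_ : _ = \bigcap_(i in [set: 'I_n.+1])
  (fun x : V => x 0%R i : measurableTypeR R) @^-1` `[(z 0 i - r)%R, (z 0 i + r)%R]%classic).
  apply: fin_bigcap_measurable => // i _.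
  rewrite -[X in measurable X]setTI; exact: measurable_coord.
by apply/seteqP; split => [x xB i _|x xB i]; [exact: xB|exact: (xB i)].
Qed.

Lemma leb_cube (z : V) (r : R) : (0 <= r)%R -> leb (cube z r) = ((2 * r) ^+ n.+1)%:E.
Proof.
move=> r0; rewrite cubeE (@lebesgue_measure_row_box _ _
  (fun i => `[(z 0 i - r)%R, (z 0 i + r)%R]%classic))//.
rewrite (eq_bigr (fun=> (2 * r)%:E)); last first.
  move=> i _; rewrite lebesgue_measure_itv /= lte_fin.
  case: ltP => [_|]; first by rewrite -EFinB; congr EFin; ring.
  by move=> h; suff -> : r = 0%R; [rewrite mulr0|lra].
by rewrite prodEFin prodr_const card_ord.
Qed.

Definition shift_energy (v : V -> R) (k : V) :=
  \int[leb]_x ((v (x + k) - v x) ^+ 2)%:E.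

Definition dirichlet (J v : V -> R) :=
  \int[leb]_x \int[leb]_y (J (x - y) * (v y - v x) ^+ 2)%:E.

Section shift_energy.
Variables (v : V -> R) (mv : measurable_fun setT v).
Implicit Types h k : V.

Lemma shift_energy_ge0 k : 0 <= shift_energy v k.
Proof. by apply: integral_ge0 => x _; rewrite lee_fin sqr_ge0. Qed.

Let measurable_shift k : measurable_fun setT (fun x : V => v (x + k)%R).
Proof. by apply: measurableT_comp => //; exact: measurable_addrow. Qed.

Let measurable_shift2 : measurable_fun setT (fun p : V * V => v (p.1 + p.2)%R).
Proof. by apply: (measurableT_comp mv); exact: measurable_row_add. Qed.

Lemma measurable_incr k : measurable_fun setT (fun x : V => ((v (x + k) - v x) ^+ 2)%:E).
Proof. by apply/measurable_EFinP/measurable_funX/measurable_funB. Qed.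

Let measurable_incr2 : measurable_fun setT (fun p : V * V => ((v (p.1 + p.2) - v p.1) ^+ 2)%:E).
Proof.
apply/measurable_EFinP/measurable_funX/measurable_funB => //.
by apply: (measurableT_comp mv); exact: measurable_fst.
Qed.

Lemma measurable_shift_energy : measurable_fun setT (shift_energy v).
Proof.
apply: (measurable_fun_fubini_tonelli_G
  (fun p : V * V => ((v (p.1 + p.2) - v p.1) ^+ 2)%:E)) => //.
by move=> x; rewrite lee_fin sqr_ge0.
Qed.

Lemma shift_energyN k : shift_energy v (- k) = shift_energy v k.
Proof.
have mI := measurable_incr.
rewrite /shift_energy -[LHS](integral_leb_translation k)//.
  by apply: eq_integral => x _; rewrite addrK -sqrrN opprB.
by move=> x; rewrite lee_fin sqr_ge0.
Qed.

(** Young's inequality (a + b)^2 <= (1 + s) a^2 + (1 + 1/s) b^2 for the two successive increments.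
    The free weight s lets m translations cost m^2 instead of a power of 2. *)
Lemma shift_energyD (s : R) h k : (0 < s)%R ->
  shift_energy v (h + k) <=
    (1 + s)%:E * shift_energy v h + (1 + s^-1)%:E * shift_energy v k.
Proof.
move=> s0; have mI := measurable_incr; have si0 : (0 < s^-1)%R by rewrite invr_gt0.
have <- : \int[leb]_x ((v (x + k + h) - v (x + k)) ^+ 2)%:E = shift_energy v h.
  apply: (integral_leb_translation k (f := fun x => ((v (x + h) - v x) ^+ 2)%:E)).
    exact: measurable_incr.
  by move=> x; rewrite lee_fin sqr_ge0.
have m1 : measurable_fun setT (fun x : V => ((v (x + k + h) - v (x + k)) ^+ 2)%:E).
  apply/measurable_EFinP/measurable_funX/measurable_funB => //.
  by apply: (eq_measurable_fun (fun x : V => v (x + (k + h))%R)) => // x _; rewrite addrA.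
have sq0 (a : R) : 0 <= (a ^+ 2)%:E by rewrite lee_fin sqr_ge0.
have Zsq0 (c a : R) : (0 < c)%R -> 0 <= (1 + c)%:E * (a ^+ 2)%:E.
  by move=> c0; rewrite mule_ge0// lee_fin addr_ge0// ltW.
rewrite -!ge0_lebZ ?addr_ge0 ?(ltW s0) ?(ltW si0)//; try by move=> x; exact: sq0.
rewrite -ge0_lebD//; try (by move=> x; exact: Zsq0); try exact: measurable_funeM.
apply: ge0_leb_le => //.
  by apply: emeasurable_funD; exact: measurable_funeM.
move=> x; rewrite -!EFinM -EFinD lee_fin.
have -> : (v (x + (h + k)) - v x = (v (x + k + h) - v (x + k)) + (v (x + k) - v x))%R.
  by rewrite [(h + k)%R]addrC addrA; ring.
move: (v (x + k + h) - v (x + k))%R (v (x + k) - v x)%R => a b.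
rewrite -subr_ge0 (_ : _ - _ = s^-1 * (s * a - b) ^+ 2)%R.
  by rewrite mulr_ge0 ?sqr_ge0// ltW.
by field; rewrite lt0r_neq0.
Qed.

Lemma shift_energy_muln m k :
  shift_energy v (k *+ m.+1) <= (m.+1%:R ^+ 2)%:E * shift_energy v k.
Proof.
elim: m => [|m ih]; first by rewrite mulr1n expr1n mul1e.
(* The weight 1 / (m + 1) closes the induction exactly: with a = m + 1, (1 + 1/a) a^2 + (1 + a) = (a
   + 1)^2. *)
rewrite mulrSr; have m0 : (0 < m.+1%:R^-1 :> R)%R by rewrite invr_gt0.
apply: (le_trans (shift_energyD _ _ m0)); rewrite invrK.
have e0 := shift_energy_ge0 k.
apply: (@le_trans _ _ ((1 + m.+1%:R^-1)%:E * ((m.+1%:R ^+ 2)%:E * shift_energy v k)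
   + (1 + m.+1%:R)%:E * shift_energy v k)).
  by apply: leeD => //; apply: lee_wpmul2l => //; rewrite lee_fin addr_ge0// ltW.
rewrite muleA -ge0_muleDl ?mule_ge0 ?lee_fin ?addr_ge0 ?mulr_ge0 ?sqr_ge0 ?(ltW m0)//.
rewrite -EFinM -EFinD lee_wpmul2r// lee_fin.
rewrite -[m.+2%:R]natr1; move: m.+1%:R m0 => a; rewrite invr_gt0 => a0.
rewrite [leLHS](_ : _ = (a + 1) ^+ 2)%R//.
by field; rewrite lt0r_neq0.
Qed.

End shift_energy.

Variables (J : V -> R) (hJ : admissible_kernel J).
Implicit Types v : V -> R.

Lemma measurable_dirichlet_integrand v : measurable_fun setT v ->
  measurable_fun setT
    (fun p : V * V => (J (p.1 - p.2) * (v p.2 - v p.1) ^+ 2)%:E).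
Proof.
move=> mv; apply/measurable_EFinP/measurable_funM.
  apply: (measurableT_comp (kernel_measurable hJ)).
  exact: measurable_row_sub.
apply/measurable_funX/measurable_funB; apply: (measurableT_comp mv).
  exact: measurable_snd.
exact: measurable_fst.
Qed.

(** Substitute y = x + h, use that J is even, and exchange the integrals. *)
Lemma dirichletE v : measurable_fun setT v ->
  dirichlet J v = \int[leb]_h ((J h)%:E * shift_energy v h).
Proof.
move=> mv.
have J0 := kernel_ge0 hJ.
have mf := measurable_dirichlet_integrand mv.
have Jsq0 z (a : R) : 0 <= (J z * a ^+ 2)%:E by rewrite lee_fin mulr_ge0 ?sqr_ge0.
have mg : measurable_fun setT
    (fun p : V * V => (J p.2 * (v (p.1 + p.2) - v p.1) ^+ 2)%:E).
  apply/measurable_EFinP/measurable_funM.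
    by apply: (measurableT_comp (kernel_measurable hJ)); exact: measurable_snd.
  apply/measurable_funX/measurable_funB; apply: (measurableT_comp mv).
    exact: measurable_row_add.
  exact: measurable_fst.
transitivity (\int[leb]_x \int[leb]_h (J h * (v (x + h) - v x) ^+ 2)%:E).
  apply: eq_integral => x _.
  rewrite -(integral_leb_translation x)//; last first.
    exact: (measurableT_comp mf (measurable_pair1 x)).
  apply: eq_integral => h _.
  by rewrite opprD addrCA subrr addr0 (kernelN hJ) [(h + x)%R]addrC.
rewrite (ge0_leb_tonelli mg)//; apply: eq_integral => h _ /=.
rewrite /shift_energy -ge0_lebZ//; first exact: measurable_incr.
by move=> x; rewrite lee_fin sqr_ge0.
Qed.

Lemma kernel_lower_bound : exists z0 r c, [/\ (0 < r)%R, (0 < c)%R &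
  forall h, cube z0 (2 * r) h -> (c <= J h)%R].
Proof.
have [z0 Jz0] : exists z0, J z0 != 0%R.
  apply: contrapT => /forallNP J0; have := kernel_mass1 hJ.
  rewrite integral0_eq; first by move=> /eqP; rewrite eqe eq_sym oner_eq0.
  by move=> z _; have /negP := J0 z; rewrite negbK => /eqP ->.
have {}Jz0 : (0 < J z0)%R by rewrite lt0r Jz0 (kernel_ge0 hJ).
have cJ : J x @[x --> z0] --> J z0 by exact: (kernel_continuous hJ).
have J2 : (J z0 / 2 < J z0)%R by rewrite ltr_pdivrMr// ltr_pMr// ltr1n.
have : \forall x \near z0, (J z0 / 2 < J x)%R by apply: (cvgr_gt (J z0) cJ).
move=> /nbhs_ballP[e /= e0 eJ].
(* With r = e / 4 the closed cube of radius 2 r = e / 2 lies in the open ball of radius e. *)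
exists z0, (e / 4)%R, (J z0 / 2)%R; split; [exact: divr_gt0|exact: divr_gt0|].
move=> h hz; apply/ltW/eJ; split => // i j; rewrite (ord1 i).
rewrite /ball /= distrC (le_lt_trans (hz j))//; lra.
Qed.

(* A short translation is the composition of two jumps that both lie in the cube
   on which J is bounded below. *)
Lemma short_shift_le : exists r C, [/\ (0 < r)%R, (0 < C)%R &
  forall v k, measurable_fun setT v -> cube 0 r k ->
    shift_energy v k <= C%:E * dirichlet J v].
Proof.
have [z0 [r [c [r0 c0 cJ]]]] := kernel_lower_bound.
have r20 : (0 < (2 * r) ^+ n.+1)%R by rewrite exprn_gt0// mulr_gt0.
(* Here 4 comes from two jumps with Young weight 2 each, c is the lower bound of J, and (2 r)^(n+1)
   is the volume of the cube over which h is averaged. *)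
exists r, (4 / c / (2 * r) ^+ n.+1)%R; split => //.
  by rewrite !divr_gt0.
move=> v k mv kr; rewrite dirichletE//.
have E0 := shift_energy_ge0 v; have mE := measurable_shift_energy mv.
have mJ : measurable_fun setT (fun h => (J h)%:E).
  by apply/measurable_EFinP; exact: kernel_measurable.
have mB := measurable_cube z0 r; have mB2 := measurable_cube z0 (2 * r)%R.
set D := \int[_]_h _.
pose I := \int[leb]_(h in cube z0 (2 * r)) shift_energy v h.
have ID : c%:E * I <= D.
  rewrite /I -ge0_integralZl_EFin ?(ltW c0)//; last exact: measurable_funTS.
  apply: (@le_trans _ _ (\int[leb]_(h in cube z0 (2 * r)) ((J h)%:E * shift_energy v h))).
    apply: ge0_le_integral => //.
    - by move=> h _; rewrite mule_ge0// lee_fin ltW.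
    - by apply: measurable_funeM; exact: measurable_funTS.
    - by apply: measurable_funTS; exact: emeasurable_funM.
    - by move=> h hB; rewrite lee_wpmul2r// lee_fin cJ.
  apply: ge0_subset_integral => //; first exact: emeasurable_funM.
  by move=> h _; rewrite mule_ge0// lee_fin (kernel_ge0 hJ).
have IB : \int[leb]_(h in cube z0 r) shift_energy v h <= I.
  apply: ge0_subset_integral => //; first exact: measurable_funTS.
  by move=> h hB i; rewrite (le_trans (hB i))// ler_pMl// ler1n.
have mEk : measurable_fun setT (fun h : V => shift_energy v (h + k)).
  by apply: (measurableT_comp mE); exact: measurable_addrow.
(* For h in the small cube, h + k stays in the cube of radius 2 r. The integral over the latter is
   translated by k after extending the integrand by zero. *)
have IBk : \int[leb]_(h in cube z0 r) shift_energy v (h + k) <= I.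
  rewrite /I [leRHS]integral_mkcond.
  rewrite -[leRHS](integral_leb_translation k); last 2 first.
  - by apply/(measurable_restrictT _ mB2); exact: measurable_funTS.
  - by move=> h; rewrite patchE; case: ifP.
  rewrite [leLHS]integral_mkcond; apply: ge0_leb_le => //.
  - by apply/(measurable_restrictT _ mB); exact: measurable_funTS.
  - by move=> h; rewrite patchE; case: ifP.
  - apply: (measurableT_comp _ (measurable_addrow k)).
    by apply/(measurable_restrictT _ mB2); exact: measurable_funTS.
  move=> h; rewrite !patchE; case: ifPn => [|_]; last by case: ifPn.
  rewrite inE => hB; rewrite ifT// inE => i.
  have := hB i; have := kr i; rewrite !mxE subr0 => ki hi.
  by rewrite addrAC (le_trans (ler_normD _ _))// mulrDl mul1r lerD.
(* Write k = (h + k) + (- h), so that E(k) <= 2 E(h + k) + 2 E(h), and integrate over h in the small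
   cube. *)
have : ((2 * r) ^+ n.+1)%:E * shift_energy v k <= 4%:E * I.
  rewrite -(leb_cube z0 (ltW r0)) muleC -integral_cst//.
  apply: (@le_trans _ _ (\int[leb]_(h in cube z0 r)
      (2%:E * shift_energy v (h + k) + 2%:E * shift_energy v h))).
    apply: ge0_le_integral => //.
    - by move=> h _; exact: E0.
    - apply: measurable_funTS.
      by apply: emeasurable_funD; exact: measurable_funeM.
    move=> h _; have := shift_energyD mv (h + k) (- h) ltr01.
    by rewrite addrAC subrr add0r invr1 shift_energyN.
  rewrite ge0_integralD//; last 4 first.
  - by move=> h _; rewrite mule_ge0.
  - by apply: measurable_funeM; exact: measurable_funTS.
  - by move=> h _; rewrite mule_ge0.
  - by apply: measurable_funeM; exact: measurable_funTS.
  rewrite !ge0_integralZl_EFin//; [|exact: measurable_funTS|exact: measurable_funTS].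
  rewrite (_ : 4%:E * I = 2%:E * I + 2%:E * I); last first.
    by rewrite -ge0_muleDl ?lee_fin// -EFinD; congr (_%:E * _); ring.
  apply: leeD; (apply: lee_wpmul2l; first by rewrite lee_fin); [exact: IBk|exact: IB].
move=> h.
have I0 : 0 <= I by exact: integral_ge0.
rewrite -(@lee_pmul2l _ ((2 * r) ^+ n.+1)%:E)// ?lte_fin// muleA -EFinM.
rewrite (_ : (2 * r) ^+ n.+1 * (4 / c / (2 * r) ^+ n.+1) = 4 * c^-1)%R; last first.
  by rewrite mulrC divfK// lt0r_neq0.
apply: (le_trans h); rewrite EFinM -muleA lee_wpmul2l//.
by rewrite lee_pdivlMl.
Qed.

End nash.

Section nash.
Context {R : realType} {n : nat}.
Notation V := 'rV[R]_n.+1.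
Notation leb := (@lebesgue_measure_row R n.+1).
Variables (J : V -> R) (hJ : admissible_kernel J).
Implicit Types v : V -> R.
Local Open Scope ereal_scope.

Lemma dirichlet_ge0 v : 0 <= dirichlet J v.
Proof.
apply: integral_ge0 => x _; apply: integral_ge0 => y _.
by rewrite lee_fin mulr_ge0 ?sqr_ge0 ?(kernel_ge0 hJ).
Qed.

(** Cut k into m + 1 equal translations, m being the integer part of rho / r. Each is short enough
    for [short_shift_le], and the cost (m + 1)^2 is at most (2 rho / r)^2 because rho >= r. *)
Lemma shift_energy_le : exists r C : R, [/\ (0 < r)%R, (0 < C)%R &
  forall (rho : R) v k, (r <= rho)%R -> measurable_fun setT v -> cube 0 rho k ->
    shift_energy v k <= (C * rho ^+ 2)%:E * dirichlet J v].
Proof.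
have [r [C [r0 C0 H]]] := short_shift_le hJ.
exists r, (4 * C / r ^+ 2)%R; split => //; first by rewrite !(divr_gt0, mulr_gt0, exprn_gt0).
move=> rho v k rrho mv krho.
have rho0 : (0 < rho)%R by exact: lt_le_trans rrho.
have q1 : (1 <= rho / r)%R by rewrite ler_pdivlMr// mul1r.
have /andP[] := truncn_itv (le_trans ler01 q1).
set m := Num.truncn _ => mq qm.
have m0 : (0 < m.+1%:R :> R)%R by [].
pose k' : V := (m.+1%:R^-1 *: k)%R.
have kE : k = (k' *+ m.+1)%R.
  by rewrite -scaler_nat scalerA divff ?scale1r// lt0r_neq0.
have k'r : cube 0 r k'.
  move=> i; have := krho i; rewrite !mxE !subr0 normrM => ki.
  rewrite gtr0_norm ?invr_gt0// ler_pdivrMl// (le_trans ki)//.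
  by rewrite -ler_pdivrMr// ltW.
rewrite kE (le_trans (shift_energy_muln mv m k'))//.
apply: (@le_trans _ _ ((m.+1%:R ^+ 2)%:E * (C%:E * dirichlet J v))).
  by rewrite lee_wpmul2l ?H// lee_fin sqr_ge0.
rewrite muleA -EFinM lee_wpmul2r ?dirichlet_ge0// lee_fin.
rewrite (_ : 4 * C / r ^+ 2 * rho ^+ 2 = (2 * (rho / r)) ^+ 2 * C)%R; last first.
  by field; rewrite lt0r_neq0.
have m2 : (m.+1%:R <= 2 * (rho / r))%R by rewrite -natr1; lra.
by rewrite ler_pM2r// ler_pXn2r// nnegrE ?(le_trans _ m2)// ltW.
Qed.

Lemma nash : exists r C : R, [/\ (0 < r)%R, (0 < C)%R &
  forall (rho : R) v, (r <= rho)%R -> measurable_fun setT v ->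
    (forall x, 0 <= v x)%R ->
    \int[leb]_x (v x ^+ 2)%:E <= (C * rho ^+ 2)%:E * dirichlet J v
      + (rho ^- n.+1)%:E * (\int[leb]_x (v x)%:E) ^+ 2].
Proof.
have [r [C [r0 C0 H]]] := shift_energy_le.
exists r, C; split => // rho v rrho mv v0.
have rho0 : (0 < rho)%R by exact: lt_le_trans rrho.
set S := \int[_]_x (v x)%:E; set I := \int[_]_x (v x ^+ 2)%:E; set D := dirichlet J v.
have I0 : 0 <= I by apply: integral_ge0 => x _; rewrite lee_fin sqr_ge0.
have S0 : 0 <= S by apply: integral_ge0 => x _; rewrite lee_fin.
have D0 : 0 <= D by exact: dirichlet_ge0.
have E0 := shift_energy_ge0 v; have mE := measurable_shift_energy mv.
pose P k := \int[leb]_x (v x * v (x + k))%:E.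
have mP2 : measurable_fun setT (fun p : V * V => (v p.1 * v (p.1 + p.2))%:E).
  apply/measurable_EFinP/measurable_funM; apply: (measurableT_comp mv).
    exact: measurable_fst.
  exact: measurable_row_add.
have vv0 x k : 0 <= (v x * v (x + k)%R)%:E by rewrite lee_fin mulr_ge0.
have P0 k : 0 <= P k by exact: integral_ge0.
have mP : measurable_fun setT P.
  by apply: (measurable_fun_fubini_tonelli_G _ mP2) => p; exact: vv0.
have mvE : measurable_fun setT (EFin \o v) by exact/measurable_EFinP.
have mshift k : measurable_fun setT (fun x : V => v (x + k)%R).
  by apply: (measurableT_comp mv); exact: measurable_addrow.
(* Over the whole space the correlations of v with its translates integrate to the square of its
   mass. *)
have PS : \int[leb]_k P k = S ^+ 2.
  rewrite -(ge0_leb_tonelli mP2); last by move=> p; exact: vv0.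
  transitivity (\int[leb]_x ((v x)%:E * S)).
    apply: eq_integral => x _.
    rewrite /S -(@integral_leb_translation _ _ x (fun y => (v y)%:E))//.
    rewrite -ge0_lebZ//; last 2 first.
    - by apply/measurable_EFinP; exact: mshift.
    - by move=> y; rewrite lee_fin.
    by apply: eq_integral => y _; rewrite EFinM addrC.
  by rewrite ge0_integralZr// => x _; rewrite lee_fin.
(* Expanding the square, in additive form so that infinite values are allowed. *)
have EP k : shift_energy v k + 2%:E * P k = 2%:E * I.
  transitivity (\int[leb]_x ((v (x + k) ^+ 2)%:E + (v x ^+ 2)%:E)).
    rewrite /P -ge0_lebZ//; last exact: (measurableT_comp mP2 (measurable_pair2 k)).
    rewrite -ge0_lebD//.
    - by apply: eq_integral => x _; rewrite -!EFinM -!EFinD; congr EFin; ring.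
    - exact: measurable_incr.
    - by move=> x; rewrite lee_fin sqr_ge0.
    - by apply: measurable_funeM; exact: (measurableT_comp mP2 (measurable_pair2 k)).
    - by move=> x; rewrite mule_ge0.
  rewrite ge0_lebD//.
  - rewrite (integral_leb_translation k (f := fun x => (v x ^+ 2)%:E)).
    + by rewrite -/I mule_natl mule2n.
    + exact/measurable_EFinP/measurable_funX.
    + by move=> x; rewrite lee_fin sqr_ge0.
  - exact/measurable_EFinP/measurable_funX.
  - by move=> x; rewrite lee_fin sqr_ge0.
  - exact/measurable_EFinP/measurable_funX.
  - by move=> x; rewrite lee_fin sqr_ge0.
have mQ := measurable_cube (0 : V) rho.
pose q := ((2 * rho) ^+ n.+1)%R.
have q0 : (0 < q)%R by rewrite exprn_gt0// mulr_gt0.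
(* Integrate the identity over the cube of radius rho, of volume q; the integral of P is enlarged to
   the whole space. After division by 2 q, the bound follows from q >= rho^(n+1). *)
have : q%:E * (2%:E * I) <= q%:E * ((C * rho ^+ 2)%:E * D) + 2%:E * S ^+ 2.
  rewrite -{1}(leb_cube 0 (ltW rho0)) muleC -integral_cst//.
  rewrite (@eq_integral _ _ _ leb _ (fun k => shift_energy v k + 2%:E * P k)); last first.
    by move=> k _; rewrite EP.
  rewrite ge0_integralD//; last 3 first.
  - exact: measurable_funTS.
  - by move=> k _; rewrite mule_ge0.
  - by apply: measurable_funTS; exact: measurable_funeM.
  apply: leeD.
    rewrite -(leb_cube 0 (ltW rho0)) muleC -integral_cst//.
    apply: ge0_le_integral => //.
    - exact: measurable_funTS.
    - by move=> k kQ; exact: H.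
  rewrite ge0_integralZl_EFin//; last exact: measurable_funTS.
  rewrite -PS; apply: lee_wpmul2l; first by rewrite lee_fin.
  by apply: ge0_subset_integral.
move=> h; rewrite -(@lee_pmul2l _ (q * 2)%:E)// ?lte_fin ?mulr_gt0//.
have A0 : 0 <= (C * rho ^+ 2)%:E * D.
  by rewrite mule_ge0// lee_fin mulr_ge0 ?sqr_ge0// ltW.
have B0 : 0 <= (rho ^- n.+1)%:E * S ^+ 2.
  by rewrite mule_ge0 ?lee_fin ?expe_ge0// invr_ge0 exprn_ge0// ltW.
rewrite (ge0_muleDr _ A0 B0) EFinM -muleA (le_trans h)//.
apply: leeD.
  rewrite -!muleA lee_wpmul2l ?lee_fin ?(ltW q0)//.
  by rewrite lee_pemull// lee_fin ler1n.
rewrite [leRHS]muleA -!EFinM lee_wpmul2r ?expe_ge0// lee_fin /q exprMn.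
rewrite mulrAC mulfK ?lt0r_neq0 ?exprn_gt0//.
by rewrite ler_pMl// exprn_ege1// ler1n.
Qed.

End nash.

(** * Energy and mass along the Euler scheme *)

Section real_leb_integral.
Context {R : realType} {n : nat}.
Implicit Types f g : 'rV[R]_n -> R.
Local Open Scope ereal_scope.

Lemma leb_integralD f g : measurable_fun setT f -> (forall x, 0 <= f x)%R ->
  measurable_fun setT g -> (forall x, 0 <= g x)%R ->
  \int['leb_n]_x (f x + g x)%:E = \int['leb_n]_x (f x)%:E + \int['leb_n]_x (g x)%:E.
Proof.
move=> mf f0 mg g0; rewrite -ge0_lebD//; try exact/measurable_EFinP.
Qed.

Lemma leb_integralZ (k : R) f : measurable_fun setT f -> (forall x, 0 <= f x)%R ->
  (0 <= k)%R -> \int['leb_n]_x (k * f x)%:E = k%:E * \int['leb_n]_x (f x)%:E.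
Proof.
move=> mf f0 k0; rewrite -ge0_lebZ//; exact/measurable_EFinP.
Qed.

Lemma leb_integral_le f g : measurable_fun setT f -> (forall x, 0 <= f x)%R ->
  measurable_fun setT g -> (forall x, 0 <= g x)%R ->
  {ae 'leb_n, forall x, f x <= g x}%R ->
  \int['leb_n]_x (f x)%:E <= \int['leb_n]_x (g x)%:E.
Proof.
move=> mf f0 mg g0 fg; apply: ae_ge0_le_integral => //.
- by move=> x _; rewrite lee_fin.
- exact/measurable_EFinP.
- by move=> x _; rewrite lee_fin.
- exact/measurable_EFinP.
- by apply: filterS fg => x fgx _; rewrite lee_fin.
Qed.

End real_leb_integral.

Section energy.
Context {R : realType} {n : nat}.
Notation V := 'rV[R]_n.+1.
Notation leb := (@lebesgue_measure_row R n.+1).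
Variables (J : V -> R) (hJ : admissible_kernel J).

Lemma measurable_avg (F : V * V -> R) : measurable_fun setT F ->
  (forall p, 0 <= F p) -> (forall x, jbounded J x (fun y => F (x, y))) ->
  measurable_fun setT (fun x => avg J x (fun y => F (x, y))).
Proof.
move=> mF F0 bF; apply/measurable_EFinP.
rewrite (_ : EFin \o _ = fun x => (\int[leb]_y (J (x - y) * F (x, y))%:E)%E); last first.
  by apply/funext => x; rewrite /= EFin_avg.
apply: (measurable_fun_fubini_tonelli_F (fun p : V * V => (J (p.1 - p.2) * F p)%:E)).
  apply/measurable_EFinP/measurable_funM => //.
  by apply: (measurableT_comp (kernel_measurable hJ)); exact: measurable_row_sub.
by move=> p; rewrite lee_fin mulr_ge0// (kernel_ge0 hJ).
Qed.

(** Tonelli, J being even and of mass 1. *)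
Lemma integral_avg (f : V -> R) : measurable_fun setT f -> (forall x, 0 <= f x) ->
  (forall x, jbounded J x f) ->
  (\int[leb]_x (avg J x f)%:E = \int[leb]_x (f x)%:E)%E.
Proof.
move=> mf f0 bf.
rewrite (@eq_integral _ _ _ leb _ (fun x => \int[leb]_y (J (x - y) * f y)%:E)%E); last first.
  by move=> x _; rewrite EFin_avg.
rewrite (ge0_leb_tonelli (f := fun p : V * V => (J (p.1 - p.2) * f p.2)%:E)); last 2 first.
- apply/measurable_EFinP/measurable_funM => //.
    by apply: (measurableT_comp (kernel_measurable hJ)); exact: measurable_row_sub.
  by apply: (measurableT_comp mf); exact: measurable_snd.
- by move=> p; rewrite lee_fin mulr_ge0// (kernel_ge0 hJ).
apply: eq_integral => y _.
transitivity ((f y)%:E * \int[leb]_x (J (y - x))%:E)%E.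
  rewrite -leb_integralZ//; last 2 first.
  - exact: measurable_kernel_sub.
  - by move=> x; exact: (kernel_ge0 hJ).
  by apply: eq_integral => x _; rewrite mulrC -(kernelN hJ) opprB.
by rewrite integral_kernel_sub// mule1.
Qed.

Variables (mu : V -> R) (mmu : measurable_fun setT mu).
Variables (b M : R) (b0 : 0 <= b) (mub : {ae leb, forall x, mu x <= b}).
Variables (v : V -> R) (mv : measurable_fun setT v) (vM : forall x, 0 <= v x <= M).

Let v0 x : 0 <= v x. Proof. by case/andP: (vM x). Qed.
Let v1 x : v x <= M. Proof. by case/andP: (vM x). Qed.
Let M0 : 0 <= M. Proof. exact: le_trans (v0 0) (v1 0). Qed.

Lemma range_jbounded x : jbounded J x v.
Proof. by apply: (@jbounded_bounded _ _ _ _ _ M) => // y; rewrite ger0_norm. Qed.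
Let jv := range_jbounded.

Let jincr x : jbounded J x (fun y => v y - v x).
Proof. exact: jbounded_incr. Qed.

Let jincr2 x : jbounded J x (fun y => (v y - v x) ^+ 2).
Proof. by under eq_fun do rewrite expr2; exact: jboundedM. Qed.

Let jflux x : jbounded J x (fun y => flux (mu x) (v y - v x)).
Proof. exact: jbounded_flux. Qed.

Let mv1 : measurable_fun setT (fun p : V * V => v p.1).
Proof. by apply: (measurableT_comp mv); exact: measurable_fst. Qed.

Let mv2 : measurable_fun setT (fun p : V * V => v p.2).
Proof. by apply: (measurableT_comp mv); exact: measurable_snd. Qed.

Let mincr : measurable_fun setT (fun p : V * V => v p.2 - v p.1).
Proof. exact: measurable_funB. Qed.

Lemma measurable_drift : measurable_fun setT (drift J mu v).
Proof.
(* The flux is at least -2 M here, so adding 2 M makes the integrand nonnegative and Tonelli gives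
   measurability in x. *)
have mF : measurable_fun setT (fun p : V * V => flux (mu p.1) (v p.2 - v p.1) + 2 * M).
  apply: measurable_funD => //; apply: measurable_flux => //.
  by apply: (measurableT_comp mmu); exact: measurable_fst.
rewrite (_ : drift J mu v = fun x =>
    avg J x (fun y => flux (mu x) (v y - v x) + 2 * M) - 2 * M); last first.
  apply/funext => x; rewrite avgD// ?avg_cst//; last exact: jbounded_cst.
  by rewrite addrK.
apply: measurable_funB => //; apply: (measurable_avg mF).
  move=> [x y]; have := norm_flux_le (mu x) (v y - v x).
  have : `|v y - v x| <= M.
    by rewrite ler_norml; have := v0 x; have := v0 y; have := v1 x; have := v1 y; lra.
  move=> h1 /=; rewrite ler_norml => /andP[h2 _]; lra.
by move=> x; apply: jboundedD => //; exact: jbounded_cst.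
Qed.

Lemma measurable_euler h : measurable_fun setT (euler J mu h v).
Proof.
by apply: measurable_funD => //; apply: measurable_funM => //; exact: measurable_drift.
Qed.

(** The density in x of the Dirichlet form. *)
Let d x := avg J x (fun y => (v y - v x) ^+ 2).
Let w x := avg J x v.

Let d0 x : 0 <= d x. Proof. by apply: avg_ge0 => // y; exact: sqr_ge0. Qed.
Let w0 x : 0 <= w x. Proof. exact: avg_ge0. Qed.

Let md : measurable_fun setT d.
Proof.
apply: (measurable_avg (F := fun p => (v p.2 - v p.1) ^+ 2)) => //.
  exact: measurable_funX.
by move=> p; exact: sqr_ge0.
Qed.

Let mw : measurable_fun setT w.
Proof. exact: (measurable_avg (F := fun p => v p.2)). Qed.

Let mv_sqr : measurable_fun setT (fun x => v x ^+ 2).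
Proof. exact: measurable_funX. Qed.

Let mvw : measurable_fun setT (fun x => v x * w x).
Proof. exact: measurable_funM. Qed.

Local Notation S := (\int[leb]_x (v x)%:E)%E.
Local Notation S2 := (\int[leb]_x (v x ^+ 2)%:E)%E.
Local Notation D := (dirichlet J v).

Let integral_d : (\int[leb]_x (d x)%:E = D)%E.
Proof. by apply: eq_integral => x _; rewrite /d EFin_avg. Qed.

Let integral_w : (\int[leb]_x (w x)%:E = S)%E.
Proof. by rewrite integral_avg. Qed.

(* Symmetrization: the integrated form of d + 2 v w = avg(v^2) + v^2. *)
Let dirichlet_cross :
  (D + 2%:E * \int[leb]_x (v x * w x)%:E = 2%:E * S2)%E.
Proof.
have jv2 x : jbounded J x (fun y => v y ^+ 2).
  by under eq_fun do rewrite expr2; exact: jboundedM.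
have vw0 x : 0 <= v x * w x by exact: mulr_ge0.
have mv2' : measurable_fun setT (fun x => avg J x (fun y => v y ^+ 2)).
  apply: (measurable_avg (F := fun p => v p.2 ^+ 2)) => //.
    exact: measurable_funX.
  by move=> p; exact: sqr_ge0.
have a0 x : 0 <= avg J x (fun y => v y ^+ 2).
  by apply: avg_ge0 => // y; exact: sqr_ge0.
rewrite -integral_d -leb_integralZ// -leb_integralD//; last 2 first.
- exact: measurable_funM.
- by move=> x; rewrite mulr_ge0.
rewrite mule_natl mule2n -{1}(integral_avg mv_sqr)//; last by move=> x; exact: sqr_ge0.
rewrite -leb_integralD//; last by move=> x; exact: sqr_ge0.
apply: eq_integral => x _; congr EFin.
have -> : d x = avg J x (fun y => v y ^+ 2 - 2 * v x * v y + v x ^+ 2).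
  by apply: eq_Rintegral => y _; congr (_ * _); ring.
rewrite avgD//; [|apply: jboundedB => //; exact: jboundedZ|exact: jbounded_cst].
rewrite avgB//; last exact: jboundedZ.
by rewrite avgZ// avg_cst// /w; ring.
Qed.

Lemma dirichlet_le : (D <= 2%:E * S2)%E.
Proof.
rewrite -dirichlet_cross leeDl// mule_ge0//.
by apply: integral_ge0 => x _; rewrite lee_fin mulr_ge0.
Qed.

Let drift_le x : mu x <= b -> drift J mu v x <= w x - v x + b / 2 * d x.
Proof.
move=> mx.
have -> : w x - v x + b / 2 * d x =
    avg J x (fun y => (v y - v x) + b / 2 * (v y - v x) ^+ 2).
  rewrite avgD//; last exact: jboundedZ.
  by rewrite avgZ// avgB// ?avg_cst//; exact: jbounded_cst.
apply: avg_le => // [|y]; last exact: flux_le.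
by apply: jboundedD => //; exact: jboundedZ.
Qed.

(** Jensen's inequality together with |flux m s| <= 2 |s|. *)
Let drift_sqr_le x : drift J mu v x ^+ 2 <= 4 * d x.
Proof.
rewrite (le_trans (avg_sqr_le hJ (jflux x)))// /d -avgZ//.
apply: avg_le => // [||y].
- by under eq_fun do rewrite expr2; exact: jboundedM.
- exact: jboundedZ.
rewrite (_ : 4 * (v y - v x) ^+ 2 = (2 * `|v y - v x|) ^+ 2); last first.
  by rewrite exprMn real_normK ?num_real//; ring.
by rewrite -real_normK ?num_real// lerXn2r// ?nnegrE ?mulr_ge0// norm_flux_le.
Qed.

(** Almost everywhere the step is at most (1 - h) v + h w + (h b / 2) d. As v and w have the same
    integral, the linear part conserves mass. All three terms are nonnegative, so the integral
    splits without any finiteness. *)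
Lemma euler_mass h : 0 <= h -> 2 * h <= 1 ->
  (\int[leb]_x (euler J mu h v x)%:E <= S + (h * b / 2)%:E * D)%E.
Proof.
move=> h0 h1; have hb0 : 0 <= h * b / 2 by rewrite divr_ge0// mulr_ge0.
have -> : (S + (h * b / 2)%:E * D = \int[leb]_x
    (((1 - h) * v x + h * w x) + h * b / 2 * d x)%:E)%E.
  have h2 : 0 <= 1 - h by lra.
  rewrite leb_integralD//; last 4 first.
  - by apply: measurable_funD; exact: measurable_funM.
  - by move=> x; rewrite addr_ge0// mulr_ge0.
  - exact: measurable_funM.
  - by move=> x; exact: mulr_ge0.
  rewrite leb_integralD//; last 4 first.
  - exact: measurable_funM.
  - by move=> x; rewrite mulr_ge0.
  - exact: measurable_funM.
  - by move=> x; rewrite mulr_ge0.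
  rewrite !leb_integralZ//.
  rewrite integral_w integral_d -ge0_muleDl ?lee_fin//.
  by rewrite -EFinD subrK mul1e.
apply: leb_integral_le.
- exact: measurable_euler.
- by move=> x; case/andP: (euler_range hJ mu x h0 h1 mv vM).
- by apply: measurable_funD; [apply: measurable_funD|]; exact: measurable_funM.
- by move=> x; rewrite !addr_ge0// mulr_ge0//; lra.
apply: filterS mub => x mx; rewrite /euler.
have : h * drift J mu v x <= h * (w x - v x + b / 2 * d x).
  by rewrite ler_wpM2l// drift_le.
by lra.
Qed.

(** Expand (v + h drift)^2. The cross term is at most 2 h v (w - v) + h M b d, whose first part
    integrates to - h D; the last term is at most 4 h^2 d. The loss is thus at least h (1 - M b - 4
    h) D, and 8 h <= delta leaves (delta / 2) h D. *)
Lemma euler_energy h (delta : R) : 0 <= h -> 0 < delta -> M * b <= 1 - delta ->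
  8 * h <= delta -> 2 * h <= 1 -> (S2 < +oo)%E ->
  (\int[leb]_x (euler J mu h v x ^+ 2)%:E + (delta / 2 * h)%:E * D <= S2)%E.
Proof.
move=> h0 delta0 Mb hdelta h1 S2fin.
have D0 := dirichlet_ge0 hJ v.
have Dfin : (D < +oo)%E.
  by rewrite (le_lt_trans dirichlet_le)// lte_mul_pinfty// lee_fin.
have h2 : 0 <= 1 - 2 * h by lra.
have vw0 x : 0 <= v x * w x by exact: mulr_ge0.
have v20 x : 0 <= v x ^+ 2 by exact: sqr_ge0.
pose X := (\int[leb]_x (v x * w x)%:E)%E.
pose c := h * M * b + 4 * h ^+ 2.
have c0 : 0 <= c by rewrite addr_ge0 ?mulr_ge0// sqr_ge0.
have step : (\int[leb]_x (euler J mu h v x ^+ 2)%:E <=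
    (1 - 2 * h)%:E * S2 + (2 * h)%:E * X + c%:E * D)%E.
  rewrite -integral_d -!leb_integralZ// ?mulr_ge0// -leb_integralD//; last 4 first.
  - exact: measurable_funM.
  - by move=> x; rewrite mulr_ge0.
  - exact: measurable_funM.
  - by move=> x; rewrite !mulr_ge0.
  rewrite -leb_integralD//; last 4 first.
  - by apply: measurable_funD; exact: measurable_funM.
  - by move=> x; rewrite addr_ge0 ?mulr_ge0.
  - exact: measurable_funM.
  - by move=> x; rewrite mulr_ge0.
  apply: leb_integral_le.
  - by apply: measurable_funX; exact: measurable_euler.
  - by move=> x; exact: sqr_ge0.
  - by do 2?apply: measurable_funD; exact: measurable_funM.
  - by move=> x; rewrite !addr_ge0// !mulr_ge0.
  apply: filterS mub => x mx; rewrite /euler.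
  have e1 : v x * drift J mu v x <= v x * (w x - v x) + M * b / 2 * d x.
    apply: (@le_trans _ _ (v x * (w x - v x + b / 2 * d x))).
      by rewrite ler_wpM2l// drift_le.
    rewrite mulrDr lerD2l mulrA -!mulrA ler_wpM2r// ?v1//.
    by rewrite !mulr_ge0.
  have e2 := drift_sqr_le x.
  have : 2 * h * (v x * drift J mu v x) <= 2 * h * (v x * (w x - v x) + M * b / 2 * d x).
    by rewrite ler_wpM2l// mulr_ge0.
  have : h ^+ 2 * drift J mu v x ^+ 2 <= h ^+ 2 * (4 * d x).
    by rewrite ler_wpM2l// sqr_ge0.
  by rewrite /c; nra.
have := dirichlet_cross; rewrite -/X => cross.
have X0 : (0 <= X)%E by apply: integral_ge0 => x _; rewrite lee_fin.
(* By the cross identity, an infinite X would make S2 infinite. With D, X and S2 finite, the rest is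
   real arithmetic, subtraction included. *)
have Xfin : (X < +oo)%E.
  rewrite ltey; apply/eqP => Xoo; move: cross.
  rewrite Xoo gt0_muley ?lte_fin// addey; last by rewrite gt_eqF// (lt_le_trans _ D0)// ltNyr.
  by move=> /esym/eqP; rewrite lt_eqF// lte_mul_pinfty// lee_fin.
have S20 : (0 <= S2)%E by apply: integral_ge0 => x _; rewrite lee_fin.
move: step cross; rewrite -(@fineK _ S2) ?ge0_fin_numE// -(@fineK _ X) ?ge0_fin_numE//.
rewrite -(@fineK _ D) ?ge0_fin_numE//.
move: (fine S2) (fine X) (fine D) (fine_ge0 D0) => s2 x' d' d'0.
rewrite -!EFinM -!EFinD => step; case=> cross.
apply: (le_trans (leeD step (lexx _))).
rewrite -EFinD lee_fin /c.
have hx : 2 * h * x' = h * (2 * s2 - d') by rewrite -cross; ring.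
have : h * d' * (M * b) <= h * d' * (1 - delta) by rewrite ler_wpM2l// mulr_ge0.
have : h * d' * (8 * h) <= h * d' * delta by rewrite ler_wpM2l// mulr_ge0.
by rewrite hx; nra.
Qed.

End energy.

(** * Convergence of the Euler scheme *)

Section uniform_path.
Context {R : realType} {V : choiceType}.
Variable u : R -> V -> R.
Hypothesis cu : {within `[0, +oo[, continuous (u : R -> {uniform V -> R})}.

Lemma uniform_path_continuous s e : 0 <= s -> 0 < e ->
  exists2 d, 0 < d & forall t, 0 <= t -> `|t - s| < d ->
    forall x, `|u t x - u s x| < e.
Proof.
move=> s0 e0; have /subspace_continuousP := cu.
have s0' : `[0, +oo[%classic s by rewrite /= in_itv /= s0.
move=> /(_ _ s0') /(_ [set g | forall x, `|g x - u s x| < e]).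
have H : nbhs (u s : {uniform V -> R}) [set g | forall x, `|g x - u s x| < e].
  apply/uniform_nbhs; exists [set p | `|p.2 - p.1| < e]; split.
    rewrite -entourage_ballE; exists e => //= -[a b] /=.
    by rewrite /ball /= distrC.
  by move=> g /= hg x; exact: hg.
move=> /(_ H); rewrite /= withinE /= => -[U + UE].
move=> /nbhs_ballP[d /= d0 dU]; exists d => // t t0 ts x.
have : (U `&` `[0, +oo[%classic) t.
  by split; [apply: dU; rewrite /ball /= distrC|rewrite /= in_itv /= t0].
by rewrite -UE => -[/(_ x)].
Qed.

(** Heine-Cantor: the local modulus at s, halved, serves all nearby times, and [0, T] is compact.
    Only s is confined to [0, T]; t may exceed T. *)
Lemma uniform_path_uniformly_continuous (T e : R) : 0 < e ->
  exists2 d, 0 < d & forall s t, 0 <= s <= T -> 0 <= t -> `|t - s| < d ->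
    forall x, `|u t x - u s x| <= e.
Proof.
move=> e0.
pose P (d s : R) := 0 <= s -> forall t, 0 <= t -> `|t - s| < d ->
    forall x, `|u t x - u s x| <= e.
have /compact_near_coveringP/(_ R 0^'+ P) cov := @segment_compact R 0 T.
have [|d /= d0 dP] := cov _ _.
  move=> s; rewrite /= in_itv /= => /andP[s0 _].
  have [d d0 hd] := uniform_path_continuous s0 (divr_gt0 e0 (ltr0n _ 2)).
  have d2 : 0 < d / 2 by rewrite divr_gt0.
  exists (ball s (d / 2), [set i | i < d / 2]).
    by split; [exact: nbhsx_ballx|exact: nbhs_right_lt].
  move=> [s' i] /= [ss' id] s'0 t t0 ts' x.
  have h1 := hd s' s'0 _ x; have h2 := hd t t0 _ x.
  rewrite (_ : u t x - u s' x = (u t x - u s x) - (u s' x - u s x)); last by ring.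
  rewrite (le_trans (ler_normB _ _))// [leRHS]splitr lerD// ltW//.
    apply: h2; rewrite (_ : t - s = (t - s') + (s' - s)); last by ring.
    rewrite (le_lt_trans (ler_normD _ _))// [ltRHS]splitr ltrD//.
      exact: lt_trans id.
    by rewrite distrC.
  apply: h1; rewrite distrC (lt_trans ss')//.
  by rewrite ltr_pdivrMr// ltr_pMr// ltr1n.
exists (d / 2); first by rewrite divr_gt0.
move=> s t /andP[s0 sT] t0 ts x.
apply: (dP (d / 2) _ _ s _ s0 t t0 ts x); rewrite /= ?in_itv /= ?s0 ?sT ?divr_gt0//.
rewrite /ball /= sub0r normrN gtr0_norm ?divr_gt0//.
by rewrite ltr_pdivrMr// ltr_pMr// ltr1n.
Qed.

End uniform_path.

Section interval_integral.
Context {R : realType}.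
Notation lambda := (@lebesgue_measure R).

Lemma Rintegral_near_cst (g : R -> R) (a b c k : R) : a <= b ->
  lambda.-integrable `[a, b] (EFin \o g) ->
  (forall t, a <= t <= b -> `|g t - c| <= k) ->
  `|\int[lambda]_(t in `[a, b]) g t - (b - a) * c| <= (b - a) * k.
Proof.
move=> ab ig gk.
have leb_ab : fine (lambda `[a, b]) = b - a.
  rewrite lebesgue_measure_itv /= lte_fin; case: ltP => //= ba.
  by apply/esym/eqP; rewrite subr_eq0 eq_le ab ba.
have icst (z : R) : lambda.-integrable `[a, b] (EFin \o (fun=> z)).
  apply: continuous_compact_integrable; first exact: segment_compact.
  by apply: continuous_subspaceT => x; exact: cvg_cst.
have mab : measurable (`[a, b] : set (measurableTypeR R)) by exact: measurable_itv.
have -> : (b - a) * c = \int[lambda]_(t in `[a, b]) c.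
  by rewrite Rintegral_cst// leb_ab mulrC.
rewrite -RintegralB//.
have igc : lambda.-integrable `[a, b] (EFin \o (fun t => g t - c)).
  rewrite (_ : EFin \o _ = (EFin \o g) \- (EFin \o (fun=> c)))%E.
    exact: integrableB.
  by apply/funext => t.
have -> : (b - a) * k = \int[lambda]_(t in `[a, b]) k.
  by rewrite Rintegral_cst// leb_ab mulrC.
rewrite (le_trans (le_normr_Rintegral _ _))//.
apply: le_Rintegral => //; exact: integrable_norm igc.
Qed.

End interval_integral.

(** * Consistency and stability of the Euler scheme *)

Section euler_convergence.
Context {R : realType} {n : nat}.
Notation V := 'rV[R]_n.+1.
Notation lambda := (@lebesgue_measure R).
Variables (J : V -> R) (hJ : admissible_kernel J) (mu u0 : V -> R).
Variables (u : R -> V -> R) (hu : cauchy_solution J mu u0 u).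

Let u_continuous t : 0 <= t -> continuous (u t).
Proof. by case: hu => h _ _; exact: h. Qed.

Let cu : {within `[0, +oo[, continuous (u : R -> {uniform V -> R})}.
Proof. by case: hu. Qed.

Let ju t x : 0 <= t -> jbounded J x (u t).
Proof. by move=> t0; apply: continuous_jbounded => //; exact: u_continuous. Qed.

Lemma cauchy_solutionE x t : 0 < t ->
  u t x = \int[lambda]_(s in `[0, t]) drift J mu (u s) x + u0 x.
Proof.
move=> t0; have [_ _ /(_ x t t0) uE] := hu.
apply: (etrans uE); apply: (congr1 (fun z => z + u0 x)).
apply: eq_Rintegral => s _; apply: eq_Rintegral => y _.
by rewrite -mulrA.
Qed.

Lemma drift_path_dist x s t e : 0 <= s -> 0 <= t ->
  (forall y, `|u t y - u s y| <= e) ->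
  `|drift J mu (u t) x - drift J mu (u s) x| <= 4 * e.
Proof. by move=> s0 t0; apply: drift_dist => //; exact: ju. Qed.

Lemma integrable_drift_path x a b : 0 <= a ->
  lambda.-integrable `[a, b] (EFin \o (fun t => drift J mu (u t) x)).
Proof.
move=> a0; apply: continuous_compact_integrable; first exact: segment_compact.
apply/subspace_continuousP => s; rewrite /= in_itv /= => /andP[as_ sb].
have s0 : 0 <= s by exact: le_trans as_.
apply/cvgrPdist_lt => e e0.
(* The drift varies by at most 4 times the variation of u, and 4 e / 5 < e. *)
have e5 : 0 < e / 5 by rewrite divr_gt0.
have [d d0 hd] := uniform_path_continuous cu s0 e5.
rewrite /= near_withinE; near=> t; rewrite /= in_itv /= => /andP[at_ tb].
have t0 : 0 <= t by exact: le_trans at_.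
have ts : `|t - s| < d.
  by rewrite distrC; near: t; exact: nbhsx_ballx.
rewrite distrC (le_lt_trans (drift_path_dist x s0 t0 (fun y => ltW (hd t t0 ts y))))//.
by lra.
Unshelve. all: by end_near. Qed.

(** The integral equation is only given for t > 0, so the initial value is recovered by letting t
    tend to 0. *)
Lemma cauchy_solution0 x : u 0 x = u0 x.
Proof.
apply/eqP; rewrite -subr_eq0 -normr_eq0 eq_le normr_ge0 andbT.
apply/ler_addgt0Pr => e e0; rewrite add0r.
have [d d0 hd] := uniform_path_continuous cu (lexx 0) (divr_gt0 e0 (ltr0n _ 2)).
have [d' d'0 hd'] := uniform_path_continuous cu (lexx 0) (ltr01 : 0 < 1 :> R).
pose K := `|drift J mu (u 0) x| + 4.
have K0 : 0 < K by rewrite ltr_wpDl.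
(* Such a t keeps u t within e / 2 of u 0, keeps the path within 1 of u 0 on [0, t], so that K
   bounds the drift there, and makes the integral at most t K <= e / 2. *)
pose t := Num.min (d / 2) (Num.min (d' / 2) (e / 2 / K)).
have t0 : 0 < t by rewrite !lt_min !divr_gt0.
have td : t < d by rewrite !gt_min ltr_pdivrMr// ltr_pMr// ltr1n.
have td' : t < d' by rewrite !gt_min [d' / 2 < d']ltr_pdivrMr// ltr_pMr// ltr1n orbT.
have tK : t * K <= e / 2 by rewrite -ler_pdivlMr// !ge_min lexx !orbT.
have h1 : `|u t x - u 0 x| < e / 2.
  by apply: hd; [exact: ltW|rewrite subr0 gtr0_norm].
have : `|\int[lambda]_(s in `[0, t]) drift J mu (u s) x - (t - 0) * 0| <= (t - 0) * K.
  apply: Rintegral_near_cst; [exact: ltW|exact: integrable_drift_path|].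
  move=> s /andP[s0 st]; rewrite subr0.
  have : `|drift J mu (u s) x - drift J mu (u 0) x| <= 4 * 1.
    apply: drift_path_dist => // y; apply/ltW/hd' => //.
    by rewrite subr0 ger0_norm// (le_lt_trans st).
  rewrite /K => h; rewrite -(subrK (drift J mu (u 0) x) (drift J mu (u s) x)).
  by rewrite (le_trans (ler_normD _ _))// addrC lerD2l (le_trans h)// mulr1.
rewrite mulr0 !subr0 => h2.
rewrite (_ : u 0 x - u0 x = (u t x - u0 x) - (u t x - u 0 x)); last by ring.
rewrite (le_trans (ler_normB _ _))// [leRHS]splitr lerD ?(ltW h1)//.
by rewrite cauchy_solutionE// addrK (le_trans h2).
Qed.

Lemma cauchy_solution_step x s t : 0 <= s -> s < t ->
  u t x - u s x = \int[lambda]_(r in `[s, t]) drift J mu (u r) x.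
Proof.
move=> s0 st; have t0 : 0 < t by exact: le_lt_trans st.
move: s0; rewrite le_eqVlt => /predU1P[<-|s0].
  by rewrite cauchy_solutionE// cauchy_solution0 addrK.
rewrite !cauchy_solutionE// opprD addrACA subrr addr0.
rewrite Rintegral_itvB ?bnd_simp ?(ltW s0) ?(ltW st)//; last exact: integrable_drift_path.
rewrite Rintegral_itv_obnd_cbnd//.
apply: integrableS (@integrable_drift_path x s t (ltW s0)) => //.
exact: subset_itv_oc_cc.
Qed.

(** The error is the integral over [s, t] of the drift at time r minus the drift at time s. *)
Lemma euler_local_error x s t e : 0 <= s -> s < t ->
  (forall r, s <= r <= t -> forall y, `|u r y - u s y| <= e) ->
  `|u t x - euler J mu (t - s) (u s) x| <= (t - s) * (4 * e).
Proof.
move=> s0 st he; rewrite /euler opprD addrA cauchy_solution_step//.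
apply: Rintegral_near_cst; [exact: ltW|exact: integrable_drift_path|].
move=> r /andP[sr rt]; apply: drift_path_dist => //; first exact: le_trans sr.
by apply: he; rewrite sr.
Qed.

Variables (M : R) (u0M : forall x, 0 <= u0 x <= M) (mmu : measurable_fun setT mu)
  (mu0 : measurable_fun setT u0).

Definition euler_iter h k := iter k (euler J mu h) u0.

Lemma euler_iter_range h k : 0 <= h -> 2 * h <= 1 ->
  measurable_fun setT (euler_iter h k) /\ forall x, 0 <= euler_iter h k x <= M.
Proof.
move=> h0 h1; elim: k => [|k [mk rk]]; first by [].
split; first by apply: (measurable_euler hJ mmu mk rk).
by move=> x; exact: (euler_range hJ mu x h0 h1 mk rk).
Qed.

(** Each step adds a local error of at most h (4 e), and since the step is nonexpansive earlier
    errors are not amplified: they just add up. *)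
Lemma euler_iter_error h e T k : 0 < h -> 2 * h <= 1 ->
  (forall s t, 0 <= s <= T -> 0 <= t -> `|t - s| <= h ->
    forall y, `|u t y - u s y| <= e) ->
  k%:R * h <= T -> forall x, `|u (k%:R * h) x - euler_iter h k x| <= k%:R * h * (4 * e).
Proof.
move=> h0 h1 he; elim: k => [|k ih] kT x.
  by rewrite !mul0r cauchy_solution0 subrr normr0.
have kh0 : 0 <= k%:R * h by rewrite mulr_ge0// ltW.
have khS : k.+1%:R * h = k%:R * h + h by rewrite -natr1 mulrDl mul1r.
have kT' : k%:R * h <= T by rewrite (le_trans _ kT)// khS lerDl ltW.
have st : k%:R * h < k.+1%:R * h by rewrite khS ltrDl.
have [mk rk] := euler_iter_range k (ltW h0) h1.
have := @euler_local_error x _ _ e kh0 st.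
have dk : k.+1%:R * h - k%:R * h = h by rewrite khS addrC addKr.
rewrite dk => loc.
have {}loc : `|u (k.+1%:R * h) x - euler J mu h (u (k%:R * h)) x| <= h * (4 * e).
  apply: loc => r /andP[sr rt]; apply: he.
  - by rewrite kh0.
  - exact: le_trans sr.
  - by rewrite ger0_norm ?subr_ge0// lerBlDl -khS.
have := euler_nonexpansive hJ mu (ltW h0) h1 (fun x => ju x kh0)
  (fun x => range_jbounded J mk rk x) (ih kT') x.
set a := u _ x in loc *; set b := euler J mu h _ x in loc *.
rewrite -/(euler_iter h k.+1 x) => stab.
rewrite khS mulrDl [leRHS]addrC.
rewrite (_ : a - _ = (a - b) + (b - euler_iter h k.+1 x)); last by ring.
by rewrite (le_trans (ler_normD _ _))// lerD.
Qed.

Lemma euler_iter_cvg t x : 0 < t ->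
  (fun m : nat => euler_iter (t / m.+1%:R) m.+1 x) @ \oo --> u t x.
Proof.
move=> t0; apply/cvgrPdist_le => e e0.
(* The error accumulated up to time t is then t (4 e') = e. *)
pose e' := e / (4 * t).
have e'0 : 0 < e' by rewrite divr_gt0// mulr_gt0.
have [d d0 hd] := uniform_path_uniformly_continuous cu t e'0.
have md : 0 < Num.min d (1 / 2) / t by rewrite divr_gt0// lt_min d0 divr_gt0.
near=> m.
have mt : m.+1%:R^-1 < Num.min d (1 / 2) / t.
  by near: m; exact: (near_infty_natSinv_lt (PosNum md)).
set h := t / m.+1%:R.
have h0 : 0 < h by rewrite divr_gt0.
have : h < Num.min d (1 / 2) by rewrite /h mulrC -ltr_pdivlMr.
rewrite lt_min => /andP[hd' h2].
have th : m.+1%:R * h = t by rewrite /h mulrC divfK.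
have h1 : 2 * h <= 1 by lra.
have := @euler_iter_error h e' t m.+1 h0 h1; rewrite th => /(_ _ (lexx t) x).
have -> : t * (4 * e') = e by rewrite /e'; field; rewrite lt0r_neq0.
by apply => s r sT r0 rs y; apply: hd => //; exact: le_lt_trans hd'.
Unshelve. all: by end_near. Qed.

End euler_convergence.

(** * Decay *)

Section discrete_decay.
Context {R : realType}.

Lemma bernoulli_ge (z : R) (N : nat) : 0 <= z -> 1 - N%:R * (1 - z) <= z ^+ N.
Proof.
move=> z0; elim: N => [|N ih]; first by rewrite mul0r subr0 expr0.
rewrite exprS; apply: (@le_trans _ _ (z * (1 - N%:R * (1 - z)))); last by rewrite ler_wpM2l.
rewrite -subr_ge0 -natr1.
rewrite (_ : _ - _ = N%:R * (1 - z) ^+ 2); last by ring.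
by rewrite mulr_ge0 ?sqr_ge0.
Qed.

(* The scale rho in the Nash inequality is made to grow like sqrt(t), with the
   rate for which both terms of the bound are supersolutions of the resulting
   linear recursion. *)
Lemma discrete_decay (N : nat) (y d : nat -> R) (h kappa C r P : R) :
  (0 < N)%N -> 0 < h -> 0 < kappa -> 0 < C -> 0 < r -> 0 <= P -> 0 <= y 0%N ->
  kappa / C * h <= r ^+ 2 ->
  (forall k, y k.+1 + kappa * h * d k <= y k) ->
  (forall k rho, r <= rho -> y k <= C * rho ^+ 2 * d k + P / rho ^+ N) ->
  forall k rho, rho = Num.sqrt (r ^+ 2 + kappa / (C * N%:R) * (k%:R * h)) ->
    y k <= 2 * P / rho ^+ N + y 0%N * ((r / rho) ^+ 2) ^+ N.
Proof.
move=> N0 h0 kappa0 C0 r0 P0 y00 hr step nash k0 rho1 rhoE.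
have N0' : 0 < N%:R :> R by rewrite ltr0n.
pose eps := kappa / (C * N%:R).
have eps0 : 0 < eps by rewrite divr_gt0// mulr_gt0.
(* The square of the scale, affine in time; it starts from r^2, so Nash applies at every step and
   the claim for k = 0 is contained in its second term. *)
pose sigma k := r ^+ 2 + eps * (k%:R * h).
have sigma_ge k' : r ^+ 2 <= sigma k'.
  by rewrite lerDl mulr_ge0 ?(ltW eps0)// mulr_ge0// ltW.
have sigma0 k' : 0 < sigma k' by rewrite (lt_le_trans _ (sigma_ge k'))// exprn_gt0.
pose rho k := Num.sqrt (sigma k).
have rho0 k' : 0 < rho k' by rewrite sqrtr_gt0.
have rho2 k' : rho k' ^+ 2 = sigma k' by rewrite sqr_sqrtr// ltW.
have rho_ge k' : r <= rho k'.
  by rewrite -(@ler_pXn2r _ 2) ?nnegrE ?(ltW r0) ?(ltW (rho0 _))// rho2.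
suff H k' : y k' <= 2 * P / rho k' ^+ N + y 0%N * ((r / rho k') ^+ 2) ^+ N.
  by rewrite rhoE; exact: H.
elim: k' => [|{}k ih].
  have -> : rho 0%N = r by rewrite /rho /sigma mul0r mulr0 addr0 sqrtr_sqr gtr0_norm.
  rewrite divff ?lt0r_neq0// !expr1n mulr1 lerDr.
  by rewrite divr_ge0 ?mulr_ge0// exprn_ge0// ltW.
pose x := eps * h / sigma k.
have x0 : 0 < x by rewrite divr_gt0// mulr_gt0.
(* x is the relative growth of sigma in one step, and theta = kappa h / (C sigma k) is the rate that
   Nash puts in the recursion; eps was chosen to give theta = N x. *)
pose theta := N%:R * x.
have thetaE : theta = kappa / C * h / sigma k.
  by rewrite /theta /x /eps; field; rewrite !lt0r_neq0.
have theta1 : theta <= 1.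
  by rewrite thetaE ler_pdivrMr// mul1r (le_trans hr).
have theta0 : 0 < theta by rewrite mulr_gt0.
have sigmaS : sigma k.+1 = sigma k * (1 + x).
  rewrite /x mulrDr mulr1 [sigma k * _]mulrC divfK ?lt0r_neq0//.
  by rewrite /sigma -natr1; ring.
pose z := rho k / rho k.+1.
have z0 : 0 < z by rewrite divr_gt0.
have z2 : z ^+ 2 * (1 + x) = 1.
  rewrite expr_div_n !rho2 sigmaS invfM mulrA divff ?lt0r_neq0// mul1r.
  by rewrite mulVf// lt0r_neq0// addr_gt0.
have x1 : 0 < 1 + x by rewrite addr_gt0.
have x2 : 0 < 1 + x / 2 by rewrite addr_gt0// divr_gt0.
have z2_ge : 1 - x <= z ^+ 2.
  rewrite -(ler_pM2r x1) z2.
  by have := sqr_ge0 x; rewrite expr2; lra.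
have z_ge : 1 - x / 2 <= z.
  have zx : 1 <= z * (1 + x / 2).
    have q0 : 0 <= z * (1 + x / 2) by rewrite mulr_ge0 ?ltW.
    have : 1 <= (z * (1 + x / 2)) ^+ 2.
      rewrite exprMn -[leLHS]z2; apply: ler_wpM2l; first exact: sqr_ge0.
      by have := sqr_ge0 x; rewrite !expr2; lra.
    by rewrite expr_ge1.
  rewrite -(ler_pM2r x2).
  by rewrite (le_trans _ zx)//; have := sqr_ge0 x; rewrite expr2; lra.
(* z = (1 + x)^(-1/2) is the ratio of consecutive scales. With p = P / rho^N, the recursion turns 2
   p into (1 - theta) 2 p + theta p = (1 - theta / 2) 2 p, at most z^N (2 p), the value at the next
   scale. *)
have zN : 1 - theta / 2 <= z ^+ N.
  apply: (le_trans _ (bernoulli_ge N (ltW z0))).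
  rewrite lerD2l lerN2 /theta -mulrA ler_pM2l//; lra.
(* The term carrying the initial value follows the homogeneous recursion, with factor 1 - theta. *)
have z2N : 1 - theta <= (z ^+ 2) ^+ N.
  apply: (le_trans _ (bernoulli_ge N (sqr_ge0 z))).
  by rewrite lerD2l lerN2 /theta ler_pM2l//; lra.
have rhoN0 : 0 < rho k ^+ N by rewrite exprn_gt0.
have rec : y k.+1 <= (1 - theta) * y k + theta * (P / rho k ^+ N).
  have := step k; have := nash k _ (rho_ge k).
  rewrite rho2 => n1 s1.
  have : theta * y k <= theta * (C * sigma k * d k + P / rho k ^+ N).
    by rewrite ler_pM2l.
  have -> : theta * (C * sigma k * d k + P / rho k ^+ N) =
      kappa * h * d k + theta * (P / rho k ^+ N).
    by rewrite mulrDr thetaE; congr (_ + _); field; rewrite !lt0r_neq0.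
  by lra.
have rhoS : rho k.+1 = rho k / z.
  by rewrite /z invf_div mulrC divfK// lt0r_neq0.
apply: (le_trans rec).
have -> : 2 * P / rho k.+1 ^+ N = z ^+ N * (2 * P / rho k ^+ N).
  by rewrite rhoS expr_div_n invf_div; field; rewrite !lt0r_neq0 ?exprn_gt0.
have -> : y 0%N * ((r / rho k.+1) ^+ 2) ^+ N =
    (z ^+ 2) ^+ N * (y 0%N * ((r / rho k) ^+ 2) ^+ N).
  rewrite rhoS invf_div (_ : r * (z / rho k) = z * (r / rho k)); last by ring.
  by rewrite !exprMn; ring.
have A0 : 0 <= 2 * P / rho k ^+ N by rewrite divr_ge0 ?mulr_ge0// ltW.
have B0 : 0 <= y 0%N * ((r / rho k) ^+ 2) ^+ N by rewrite mulr_ge0// exprn_ge0// sqr_ge0.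
have h1 : (1 - theta / 2) * (2 * P / rho k ^+ N) <= z ^+ N * (2 * P / rho k ^+ N).
  by rewrite ler_wpM2r.
have h2 : (1 - theta) * (y 0%N * ((r / rho k) ^+ 2) ^+ N) <=
   (z ^+ 2) ^+ N * (y 0%N * ((r / rho k) ^+ 2) ^+ N).
  by rewrite ler_wpM2r.
have h3 : (1 - theta) * y k <=
    (1 - theta) * (2 * P / rho k ^+ N + y 0%N * ((r / rho k) ^+ 2) ^+ N).
  by rewrite ler_wpM2l// subr_ge0.
move: h1 h2 h3 {A0 B0}.
rewrite -![2 * P / _]mulrA; move: (P / _) (y 0%N * _) (z ^+ N) ((z ^+ 2) ^+ N) => p q zn z2n.
by move=> h1 h2 h3; lra.
Qed.

End discrete_decay.

Section leb_positivity.
Context {R : realType} {n : nat}.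
Notation V := 'rV[R]_n.+1.
Notation leb := (@lebesgue_measure_row R n.+1).

Lemma leb_setT_gt0 : (0 < leb setT)%E.
Proof.
apply: (@lt_le_trans _ _ (leb (cube 0 1))).
  by rewrite leb_cube// lte_fin exprn_gt0// mulr_gt0.
by apply: le_measure => //; rewrite inE//; exact: measurable_cube.
Qed.

(** A violation at one point would persist on a cube, which has positive measure. *)
Lemma continuous_ae_le (f : V -> R) (M : R) : continuous f ->
  {ae leb, forall x, f x <= M} -> forall x, f x <= M.
Proof.
move=> cf aef x; rewrite leNgt; apply/negP => Mfx.
have cfx : f y @[y --> x] --> f x by exact: cf.
have : \forall y \near x, M < f y by exact: (cvgr_gt (f x) cfx).
move=> /nbhs_ballP[e /= e0 eM].
case: aef => N [mN N0 subN].
have : (leb (cube x (e / 2)) <= leb N)%E.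
  apply: le_measure; rewrite ?inE//; first exact: measurable_cube.
  move=> y xy; apply: subN => /=; apply/negP; rewrite -ltNge; apply: eM.
  split => // i j; rewrite (ord1 i) /ball /= distrC (le_lt_trans (xy j))//.
  by rewrite ltr_pdivrMr// ltr_pMr// ltr1n.
have e2 : 0 < e / 2 by rewrite divr_gt0.
by rewrite N0 (leb_cube _ (ltW e2)) lee_fin leNgt exprn_gt0// mulr_gt0.
Qed.

End leb_positivity.

(** * Mass bound and decay of the Euler iterates *)

Section euler_iter_decay.
Context {R : realType} {n : nat}.
Notation V := 'rV[R]_n.+1.
Notation leb := (@lebesgue_measure_row R n.+1).
Variables (J : V -> R) (hJ : admissible_kernel J).
Variables (r C : R) (r0 : 0 < r) (C0 : 0 < C).
Hypothesis nashJ : forall (rho : R) (v : V -> R), r <= rho ->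
  measurable_fun setT v -> (forall x, 0 <= v x) ->
  (\int[leb]_x (v x ^+ 2)%:E <= (C * rho ^+ 2)%:E * dirichlet J v
      + (rho ^- n.+1)%:E * (\int[leb]_x (v x)%:E) ^+ 2)%E.
Variables (mu u0 : V -> R) (mmu : measurable_fun setT mu)
  (mu0 : measurable_fun setT u0).
Variables (b M s0 delta h : R).
Hypotheses (b0 : 0 <= b) (mub : {ae leb, forall x, mu x <= b})
  (u0M : forall x, 0 <= u0 x <= M) (u0s : (\int[leb]_x (u0 x)%:E = s0%:E)%E)
  (delta0 : 0 < delta) (Mb : M * b <= 1 - delta)
  (h0 : 0 < h) (h1 : 8 * h <= delta) (h2 : 2 * h <= 1)
  (h3 : delta / 2 / C * h <= r ^+ 2).

Let v k := euler_iter J mu u0 h k.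

Let mv k : measurable_fun setT (v k).
Proof. exact: (euler_iter_range hJ u0M mmu mu0 k (ltW h0) h2).1. Qed.

Let vM k x : 0 <= v k x <= M.
Proof. exact: (euler_iter_range hJ u0M mmu mu0 k (ltW h0) h2).2. Qed.

Let v0 k x : 0 <= v k x. Proof. by case/andP: (vM k x). Qed.

Let M0 : 0 <= M. Proof. by have /andP[p q] := u0M 0; exact: le_trans p q. Qed.

Let S k := (\int[leb]_x (v k x)%:E)%E.
Let S2 k := (\int[leb]_x (v k x ^+ 2)%:E)%E.
Let D k := dirichlet J (v k).

Let S_ge0 k : (0 <= S k)%E.
Proof. by apply: integral_ge0 => x _; rewrite lee_fin. Qed.

Let S2_ge0 k : (0 <= S2 k)%E.
Proof. by apply: integral_ge0 => x _; rewrite lee_fin sqr_ge0. Qed.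

Let D_ge0 k : (0 <= D k)%E. Proof. exact: dirichlet_ge0. Qed.

Let S2_le k : (S2 k <= M%:E * S k)%E.
Proof.
rewrite /S -leb_integralZ//; apply: leb_integral_le => //.
- exact: measurable_funX.
- by move=> x; exact: sqr_ge0.
- exact: measurable_funM.
- by move=> x; exact: mulr_ge0.
by apply: nearW => x; rewrite expr2 ler_wpM2r//; case/andP: (vM k x).
Qed.

Let mass k : (S k.+1 <= S k + (h * b / 2)%:E * D k)%E.
Proof. exact: (euler_mass hJ mmu b0 mub (mv k) (vM k) (ltW h0) h2). Qed.

(** Finiteness propagates from u0, since D <= 2 S2 <= 2 M S at each step. *)
Let S_fin k : (S k < +oo)%E.
Proof.
elim: k => [|k ih]; first by rewrite /S u0s ltry.
rewrite (le_lt_trans (mass k))// lte_add_pinfty// lte_mul_pinfty//.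
  by rewrite lee_fin divr_ge0// mulr_ge0// ltW.
rewrite (le_lt_trans (dirichlet_le hJ (mv k) (vM k)))// lte_mul_pinfty ?lee_fin//.
by rewrite (le_lt_trans (S2_le k))// lte_mul_pinfty ?lee_fin.
Qed.

Let S2_fin k : (S2 k < +oo)%E.
Proof. by rewrite (le_lt_trans (S2_le k))// lte_mul_pinfty ?lee_fin. Qed.

Let D_fin k : (D k < +oo)%E.
Proof.
rewrite (le_lt_trans (dirichlet_le hJ (mv k) (vM k)))// lte_mul_pinfty ?lee_fin//.
exact: S2_fin.
Qed.

Let energy k : (S2 k.+1 + (delta / 2 * h)%:E * D k <= S2 k)%E.
Proof.
exact: (euler_energy hJ mmu b0 mub (mv k) (vM k) (ltW h0) delta0 Mb h1 h2 (S2_fin k)).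
Qed.

Let s k := fine (S k).
Let y k := fine (S2 k).
Let d k := fine (D k).

Let SE k : S k = (s k)%:E. Proof. by rewrite fineK// ge0_fin_numE. Qed.
Let S2E k : S2 k = (y k)%:E. Proof. by rewrite fineK// ge0_fin_numE. Qed.
Let DE k : D k = (d k)%:E. Proof. by rewrite fineK// ge0_fin_numE. Qed.

(** The mass gained in a step, (h b / 2) D, is b / delta times the energy lost, (delta / 2) h D. The
    sum telescopes to at most (b / delta) y 0, and y 0 <= M s0. *)
Lemma euler_iter_mass_le k : s k <= (1 + b * M / delta) * s0.
Proof.
have y0 j : 0 <= y j by exact: fine_ge0.
have sy : s k <= s 0%N + b / delta * (y 0%N - y k).
  elim: k => [|k ih]; first by rewrite subrr mulr0 addr0.
  have := mass k; rewrite !SE DE -EFinM -EFinD lee_fin => sS.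
  have := energy k; rewrite !S2E DE -EFinM -EFinD lee_fin => yS.
  have : b / delta * (delta / 2 * h * d k) <= b / delta * (y k - y k.+1).
    by rewrite ler_wpM2l ?divr_ge0 ?(ltW delta0)//; lra.
  have -> : b / delta * (delta / 2 * h * d k) = h * b / 2 * d k.
    by field; rewrite lt0r_neq0.
  by move: ih sS; rewrite !mulrBr; lra.
have s0E : s 0%N = s0 by apply: EFin_inj; rewrite -SE /S u0s.
have y0s : y 0%N <= M * s0.
  by have := S2_le 0; rewrite S2E SE -EFinM lee_fin s0E.
rewrite (le_trans sy)// s0E mulrDl mul1r lerD2l.
rewrite (_ : b * M / delta * s0 = b / delta * (M * s0)); last by ring.
rewrite ler_wpM2l ?divr_ge0 ?(ltW delta0)//.
by have := y0 k; lra.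
Qed.

Lemma euler_iter_decay k rho :
  rho = Num.sqrt (r ^+ 2 + delta / 2 / (C * n.+1%:R) * (k%:R * h)) ->
  (\int[leb]_x (euler_iter J mu u0 h k x ^+ 2)%:E <=
  (2 * ((1 + b * M / delta) * s0) ^+ 2 / rho ^+ n.+1
    + M * s0 * ((r / rho) ^+ 2) ^+ n.+1)%:E)%E.
Proof.
move=> rhoE; rewrite -/(S2 k) S2E lee_fin.
have y0 : 0 <= y 0%N by exact: fine_ge0.
set P := ((1 + b * M / delta) * s0) ^+ 2.
have s_ge0 j : 0 <= s j by exact: fine_ge0.
have := @discrete_decay R n.+1 y d h (delta / 2) C r P isT h0 (divr_gt0 delta0 (ltr0n _ 2))
  C0 r0 (sqr_ge0 _) y0 h3.
move=> H; apply: (le_trans (H _ _ _ _ rhoE)).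
- by move=> j; have := energy j; rewrite !S2E DE -EFinM -EFinD lee_fin.
- move=> j rho' rrho'; have rho'0 : 0 < rho' by exact: lt_le_trans rrho'.
  have := nashJ rrho' (mv j) (v0 j); rewrite -/(S2 j) -/(S j) -/(D j) S2E SE DE.
  rewrite -EFin_expe -!EFinM -EFinD lee_fin => /le_trans; apply.
  rewrite lerD2l mulrC ler_wpM2r ?invr_ge0 ?exprn_ge0 ?(ltW rho'0)//.
  by rewrite /P lerXn2r ?nnegrE ?(le_trans (s_ge0 j)) ?euler_iter_mass_le.
rewrite lerD2l; apply: ler_wpM2r; first exact/exprn_ge0/sqr_ge0.
have s0E : s 0%N = s0 by apply: EFin_inj; rewrite -SE /S u0s.
by have := S2_le 0; rewrite S2E SE -EFinM lee_fin s0E.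
Qed.

End euler_iter_decay.

(** * Norms, passage to the limit and conclusion *)

Section Lnorm_leb.
Context {R : realType} {n : nat}.
Notation V := 'rV[R]_n.+1.
Notation leb := (@lebesgue_measure_row R n.+1).

Lemma Lnorm2_sqr (f : V -> R) :
  ('N[leb]_2%:E[EFin \o f] ^+ 2 = \int[leb]_x (f x ^+ 2)%:E)%E.
Proof.
have powe2 (x : \bar R) : (0 <= x -> x ^+ 2 = x `^ 2)%E.
  case: x => [r r0|_|//]; last by rewrite poweRyr// expe2 mulyy.
  by rewrite poweR_EFin powR_mulrn// -EFin_expe.
rewrite powe2 ?Lnorm_ge0// poweR_Lnorm//.
apply: eq_integral => x _ /=.
by rewrite powR_mulrn// real_normK// num_real.
Qed.

Lemma Linfty_bound (f : V -> R) : f \in Lfun leb +oo%E ->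
  [/\ measurable_fun setT f, 0 <= fine 'N[leb]_+oo[EFin \o f],
   ('N[leb]_+oo[EFin \o f] = (fine 'N[leb]_+oo[EFin \o f])%:E)%E &
   {ae leb, forall x, `|f x| <= fine 'N[leb]_+oo[EFin \o f]}].
Proof.
move=> fL; have N0 := Lnorm_ge0 leb +oo%E (EFin \o f).
have mf : measurable_fun setT f by have := sub_Lfun_mfun fL; rewrite inE.
have Nfin : ('N[leb]_+oo[EFin \o f] < +oo)%E by have := sub_Lfun_finLfun fL; rewrite inE.
have NE : ('N[leb]_+oo[EFin \o f] = (fine 'N[leb]_+oo[EFin \o f])%:E)%E.
  by rewrite fineK// ge0_fin_numE.
split => //; first exact: fine_ge0.
have : {ae leb, forall x, (abse (EFin (f x)) <= 'N[leb]_+oo[EFin \o f])%E}.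
  (* The norm with exponent +oo is the essential supremum only when the whole space has positive
     measure. *)
  by rewrite unlock leb_setT_gt0; exact: ess_sup_ge.
by apply: filterS => x; rewrite NE lee_fin.
Qed.

End Lnorm_leb.

Section fatou_bound.
Context {R : realType} {n : nat}.
Notation leb := (@lebesgue_measure_row R n).
Local Open Scope ereal_scope.

Lemma integral_sqr_lim_le (f : nat -> 'rV[R]_n -> R) (g : 'rV[R]_n -> R) (B : \bar R) :
  (\forall m \near \oo, measurable_fun setT (f m)) ->
  (forall x, f m x @[m --> \oo] --> g x) ->
  (\forall m \near \oo, \int[leb]_x (f m x ^+ 2)%:E <= B) ->
  \int[leb]_x (g x ^+ 2)%:E <= B.
Proof.
move=> mf fg fB.
have [m0 _ hm0] : \forall m \near \oo,
    measurable_fun setT (f m) /\ \int[leb]_x (f m x ^+ 2)%:E <= B.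
  by near=> m; split; near: m.
(* The hypotheses hold for large m only, so the sequence is shifted before applying Fatou. *)
pose F m x := (f (m + m0)%N x ^+ 2)%:E.
have Fg x : limn_einf (F^~ x) = (g x ^+ 2)%:E.
  apply: (cvg_limn_einf_sup _).1; apply: cvg_EFin; first exact: nearW.
  apply: (@cvgM _ _ _ _ (fun m => f (m + m0)%N x) (fun m => f (m + m0)%N x)).
    by rewrite (cvg_shiftn m0 (f^~ x)).
  by rewrite (cvg_shiftn m0 (f^~ x)).
rewrite (@eq_integral _ _ _ leb _ (fun x => limn_einf (F^~ x))); last first.
  by move=> x _; rewrite Fg.
apply: (le_trans (fatou leb measurableT _ _)).
- move=> m; apply/measurable_EFinP/measurable_funX.
  by case: (hm0 (m + m0)%N) => //=; rewrite leq_addl.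
- by move=> m x _; rewrite lee_fin sqr_ge0.
rewrite limn_einf_lim; apply: lime_le; first exact: is_cvg_einfs.
apply: nearW => m; apply: (@le_trans _ _ (\int[leb]_x F m x)).
  by apply: ereal_inf_lbound; exists m => /=.
by case: (hm0 (m + m0)%N) => //=; rewrite leq_addl.
Unshelve. all: by end_near. Qed.

End fatou_bound.

Lemma powRN_half (R : realType) (t : R) (N : nat) : 0 <= t ->
  t `^ (- (N%:R / 2)) = (Num.sqrt t ^+ N)^-1.
Proof.
by move=> t0; rewrite powRN mulrC powRrM powR12_sqrt// powR_mulrn// sqrtr_ge0.
Qed.

(** Choosing [Ct] after n and J but before mu, u0 and u expresses that the constant depends only on
    N, J and the two norms; the time from which the bound holds may depend on all the data. *)
Theorem theorem2p17 (R : realType) (n : nat) (J : 'rV[R]_n.+1 -> R)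
  (hJ : admissible_kernel J) :
  exists Ct : R -> R -> R,
    forall (mu u0 : 'rV[R]_n.+1 -> R) (u : R -> 'rV[R]_n.+1 -> R),
      mu \in Lfun 'leb_n.+1 +oo%E ->
      {ae 'leb_n.+1, forall x, 0 <= mu x} ->
      (forall x, 0 < u0 x) ->
      u0 \in Lfun 'leb_n.+1 1%E ->
      u0 \in Lfun 'leb_n.+1 +oo%E ->
      continuous u0 ->
      ('N['leb_n.+1]_+oo[EFin \o u0] * 'N['leb_n.+1]_+oo[EFin \o mu] < 1)%E ->
      cauchy_solution J mu u0 u ->
      let C := Ct (fine 'N['leb_n.+1]_+oo[EFin \o mu])
                  (fine 'N['leb_n.+1]_+oo[EFin \o u0]) in
      0 < C /\
      \forall t \near +oo%R,
        ('N['leb_n.+1]_2%:E[EFin \o u t] ^+ 2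
         <= C%:E * 'N['leb_n.+1]_1[EFin \o u0] ^+ 2
            * (t `^ (- (n.+1%:R / 2)))%:E)%E.
Proof.
have [r [C [r0 C0 nashJ]]] := nash hJ.
(* The 3 is 2 from the decay bound plus 1 for its transient term, the square comes from the mass
   bound, and the denominator from rho >= sqrt eps sqrt t. *)
exists (fun b M => 3 * (1 + b * M / (1 - M * b)) ^+ 2 /
  Num.sqrt ((1 - M * b) / 2 / (C * n.+1%:R)) ^+ n.+1).
move=> mu u0 u muL _ u0pos u0L1 u0L cu0 normlt hu.
have [mmu b0 bE aeb] := Linfty_bound muL.
have [mu0 M0 ME aeM] := Linfty_bound u0L.
rewrite bE ME in normlt.
set b := fine ('N['leb_n.+1]_+oo[EFin \o mu])%E in normlt b0 aeb *.
set M := fine ('N['leb_n.+1]_+oo[EFin \o u0])%E in normlt M0 aeM *.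
move=> Ct; pose delta := 1 - M * b.
have delta0 : 0 < delta by rewrite subr_gt0 -lte_fin EFinM.
have Mb : M * b <= 1 - delta by rewrite /delta opprB addrC subrK.
pose eps := delta / 2 / (C * n.+1%:R).
have eps0 : 0 < eps by rewrite !divr_gt0// mulr_gt0.
pose A := 1 + b * M / delta.
have A1 : 1 <= A by rewrite lerDl divr_ge0 ?mulr_ge0// ltW.
have A0 : 0 < A by exact: lt_le_trans A1.
have CtE : Ct = 3 * A ^+ 2 / Num.sqrt eps ^+ n.+1 by [].
have sqeps0 : 0 < Num.sqrt eps by rewrite sqrtr_gt0.
split; first by rewrite CtE divr_gt0 ?mulr_gt0 ?exprn_gt0.
have u0M x : 0 <= u0 x <= M.
  rewrite (ltW (u0pos x)) /=; apply: continuous_ae_le => //.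
  by apply: filterS aeM => y; exact/le_trans/ler_norm.
have mub : {ae 'leb_n.+1, forall x, mu x <= b}.
  by apply: filterS aeb => y; exact/le_trans/ler_norm.
have N1E : ('N['leb_n.+1]_1[EFin \o u0] = \int['leb_n.+1]_x (u0 x)%:E)%E.
  by rewrite Lnorm1; apply: eq_integral => x _; rewrite /= gtr0_norm.
have N1fin : ('N['leb_n.+1]_1[EFin \o u0] < +oo)%E.
  by have := sub_Lfun_finLfun u0L1; rewrite inE.
pose s0 := fine ('N['leb_n.+1]_1[EFin \o u0])%E.
have s00 : 0 <= s0 by apply: fine_ge0; exact: Lnorm_ge0.
have s0E : ('N['leb_n.+1]_1[EFin \o u0] = s0%:E)%E.
  by rewrite fineK// ge0_fin_numE// Lnorm_ge0.
have u0s : (\int['leb_n.+1]_x (u0 x)%:E = s0%:E)%E by rewrite -N1E s0E.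
pose P := (A * s0) ^+ 2.
have P0 : 0 <= P by exact: sqr_ge0.
(* Once rho >= 1 + K, one has K <= rho <= rho^(n+1), and the transient term, of order rho^(-2(n+1)),
   is at most P / rho^(n+1). If s0 = 0 then P = 0 and the quotient is 0 by convention; that case is
   treated apart. *)
pose K := M * s0 * (r ^+ 2) ^+ n.+1 / P.
have K0 : 0 <= K.
  by apply: divr_ge0 => //; apply: mulr_ge0; [exact: mulr_ge0|exact/exprn_ge0/sqr_ge0].
near=> t.
have t0 : 0 < t by near: t; exact: nbhs_pinfty_gt.
have tK : (1 + K) ^+ 2 / eps <= t by near: t; apply: nbhs_pinfty_ge; exact: num_real.
pose rho := Num.sqrt (r ^+ 2 + eps * t).
have sigma_ge : eps * t <= r ^+ 2 + eps * t by rewrite lerDr sqr_ge0.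
have epst0 : 0 < eps * t by rewrite mulr_gt0.
have rho0 : 0 < rho by rewrite sqrtr_gt0 (lt_le_trans epst0).
have rho_ge : Num.sqrt eps * Num.sqrt t <= rho.
  by rewrite -sqrtrM ?(ltW eps0)// ler_wsqrtr.
have rhoK : 1 + K <= rho.
  have K1 : 0 <= 1 + K by rewrite addr_ge0.
  rewrite -[leLHS]ger0_norm// -sqrtr_sqr ler_wsqrtr//.
  by rewrite (le_trans _ sigma_ge)// mulrC -ler_pdivrMr.
have rhoN0 : 0 < rho ^+ n.+1 by rewrite exprn_gt0.
have transient : M * s0 * ((r / rho) ^+ 2) ^+ n.+1 <= P / rho ^+ n.+1.
  rewrite expr_div_n expr_div_n mulrA ler_pdivrMr; last exact/exprn_gt0/exprn_gt0.
  rewrite (_ : (rho ^+ 2) ^+ n.+1 = rho ^+ n.+1 * rho ^+ n.+1); last first.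
    by rewrite -exprMn -expr2.
  rewrite mulrA divfK ?lt0r_neq0//.
  have [s0z|s0nz] := eqVneq s0 0.
    by rewrite s0z mulr0 mul0r; apply: mulr_ge0 => //; exact: ltW.
  have Ppos : 0 < P by rewrite exprn_gt0// mulr_gt0// lt0r s0nz.
  have Krho : K <= rho by apply: le_trans rhoK; rewrite lerDr.
  have rho_le : rho <= rho ^+ n.+1.
    by rewrite ler_eXnr// (le_trans _ rhoK)// lerDl.
  by rewrite [leRHS]mulrC -ler_pdivrMr//; exact: (le_trans Krho).
rewrite Lnorm2_sqr s0E powRN_half ?(ltW t0)// -EFin_expe -!EFinM.
apply: (@le_trans _ _ (3 * P / rho ^+ n.+1)%:E); last first.
  rewrite lee_fin CtE /P exprMn.
  rewrite (_ : 3 * A ^+ 2 / Num.sqrt eps ^+ n.+1 * s0 ^+ 2 / Num.sqrt t ^+ n.+1 =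
    3 * (A ^+ 2 * s0 ^+ 2) / (Num.sqrt eps * Num.sqrt t) ^+ n.+1); last first.
    rewrite exprMn; field.
    by rewrite !lt0r_neq0// ?exprn_gt0// sqrtr_gt0.
  have st0 : 0 < Num.sqrt eps * Num.sqrt t by rewrite mulr_gt0// sqrtr_gt0.
  apply: ler_wpM2l; first by apply: mulr_ge0 => //; apply: mulr_ge0; exact: sqr_ge0.
  rewrite lef_pV2 ?posrE ?exprn_gt0//.
  by rewrite lerXn2r// nnegrE ltW.
apply: (@le_trans _ _ (2 * P / rho ^+ n.+1 + M * s0 * ((r / rho) ^+ 2) ^+ n.+1)%:E); last first.
  rewrite lee_fin -[2 * P / _]mulrA -[3 * P / _]mulrA.
  by move: transient; move: (P / _) (M * s0 * _) => p q; lra.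
(* The step must be small for the energy estimate, for the comparison principle and for theta <= 1
   in the recursion. *)
pose eta := Num.min (delta / 8) (Num.min (1 / 2) (r ^+ 2 / (delta / 2 / C))).
have eta0 : 0 < eta / t.
  by rewrite divr_gt0// !lt_min !divr_gt0// ?exprn_gt0// divr_gt0.
have small : \forall m \near \oo, t / m.+1%:R < eta.
  near=> m; rewrite mulrC -ltr_pdivlMr//.
  by near: m; exact: (near_infty_natSinv_lt (PosNum eta0)).
have smallE m : t / m.+1%:R < eta -> [/\ 0 < t / m.+1%:R, 8 * (t / m.+1%:R) <= delta,
    2 * (t / m.+1%:R) <= 1 & delta / 2 / C * (t / m.+1%:R) <= r ^+ 2].
  have : 0 < t / m.+1%:R by rewrite divr_gt0.
  move: (t / _) => h h0; rewrite !lt_min => /andP[h1 /andP[h2 h3]].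
  split; [exact: h0|lra|lra|].
  by rewrite mulrC -ler_pdivlMr ?divr_gt0// ltW.
(* After m + 1 steps of size t / (m + 1) the elapsed time is t for every m, so the iterates share
   one bound, which passes to u t by Fatou. *)
apply: (integral_sqr_lim_le
  (f := fun m => euler_iter J mu u0 (t / m.+1%:R) m.+1)).
- apply: filterS small => m /smallE[h0 _ h2 _].
  exact: (euler_iter_range hJ u0M mmu mu0 m.+1 (ltW h0) h2).1.
- by move=> x; apply: euler_iter_cvg hu _ u0M mmu mu0 _ _ t0.
- apply: filterS small => m /smallE[h0 h1 h2 h3].
  apply: (euler_iter_decay hJ r0 C0 nashJ mmu mu0 b0 mub u0M u0s delta0 Mb h0 h1 h2 h3).
  by rewrite [_ * (t / _)]mulrC divfK.
Unshelve. all: by end_near. Qed.
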